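(* Let $A$ be a strongly graded connected $S$-ring. Assume that there exists a bimodule of relations $R\subseteq T_A$ for $A$ and that $A^1$ and $R$ are projective as left $S$-modules. Then $c(A)\le c_A+2$, where $c(A)$ is the homological complexity of $A$ and $c_A=\sup\{n-1\mid A^n\ne0\}$ is the complexity of $A$ as a graded $S$-module. In particular, $c(A)$ is finite whenever $c_A$ is finite.
   Context: $S$ is an associative unital ring. A positively graded $S$-ring $A=\bigoplus_{n\ge0}A^n$ is connected if $A^0=S$ and strongly graded if $A^nA^m=A^{n+m}$ for all $n,m$. $T_A:=T_S(A^1)$ is the tensor $S$-ring and $I_A$ is the kernel of the canonical surjection $T_A\to A$. A bimodule of relations for $A$ is a graded $S$-subbimodule $R\subseteq I_A$ with $I_A=R\oplus(A^1I_A+I_AA^1)$. The homological complexity $c(A)$ is $-1$ if $\operatorname{Tor}_3^A(S,S)=0$, and otherwise $c(A)=\sup\{n-1\mid\operatorname{Tor}^A_{3,n}(S,S)\ne0\}$, where $n$ denotes the internal degree induced by the grading of $A$. *)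

(* Defs.v *)
From HB Require Import structures.
From mathcomp Require Import all_boot all_order all_algebra.
From mathcomp Require Import generic_quotient ring_quotient.
From mathcomp Require Import boolp classical_sets constructive_ereal.
From mathcomp Require Import freeg.

Set Implicit Arguments.
Unset Strict Implicit.
Unset Printing Implicit Defensive.
Import Order.TTheory GRing.Theory Num.Theory.
Local Open Scope classical_set_scope.
Local Open Scope ring_scope.
Local Open Scope quotient_scope.

(* Conventions.  An S-ring (a ring A with a unital ring morphism S -> A, S not
   necessarily commutative) is an [lalgType S]: the structure morphism is
   [in_alg A : s |-> s%:A], and S acts on the left by [s *: a = s%:A * a] and
   on the right by [a * s%:A].  Left A-modules are [lmodType A], right
   A-modules are [lmodType A^c].  Subgroups and submodules are boolean
   predicates, which by classical logic capture all subsets. *)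

Record submod (S : pzRingType) (L : lmodType S) (K : submodClosed L) :=
  Submod { submod_val : L; _ : submod_val \in K }.

Section SubmodInstances.
Variables (S : pzRingType) (L : lmodType S) (K : submodClosed L).
HB.instance Definition _ := [isSub for @submod_val S L K].
HB.instance Definition _ := [Choice of submod K by <:].
HB.instance Definition _ := [SubChoice_isSubLmodule of submod K by <:].
End SubmodInstances.

Definition projective (A : pzRingType) (P : lmodType A) : Prop :=
  forall (M N : lmodType A) (g : {linear M -> N}) (f : {linear P -> N}),
    (forall y, exists x, g x = y) ->
    exists h : {linear P -> M}, forall p, g (h p) = f p.

(* V is the internal direct sum of the [gr n]. *)
Definition is_direct_sum (V : zmodType) (gr : nat -> {pred V}) : Prop :=
  (forall v, exists n (c : nat -> V),
     (forall i, c i \in gr i) /\ v = \sum_(i < n) c i) /\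
  (forall n (c : nat -> V), (forall i, c i \in gr i) ->
     \sum_(i < n) c i = 0 -> forall i, (i < n)%N -> c i = 0).

(* The additive subgroup generated by the products x * y, x in X, y in Y;
   it suffices to take sums since X is a subgroup in all uses below. *)
Definition mulspan (A : pzRingType) (X Y : set A) : set A :=
  [set a | exists s : seq (A * A),
     (forall u, u \in s -> X u.1 /\ Y u.2) /\ a = \sum_(u <- s) u.1 * u.2].

Section GradedRing.
Variables (S : nzRingType) (A : lalgType S) (gr : nat -> submodClosed A).

Definition is_graded_ring : Prop :=
  [/\ is_direct_sum gr,
      (1 : A) \in gr 0 &
      forall n m a b, a \in gr n -> b \in gr m -> a * b \in gr (n + m)%N].

Definition is_connected : Prop :=
  injective (in_alg A) /\ range (in_alg A) = [set` gr 0].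

Definition is_strongly_graded : Prop :=
  forall n m, mulspan [set` gr n] [set` gr m] = [set` gr (n + m)%N].

(* The projection A -> A^0 = S. *)
Definition is_augmentation (eps : {rmorphism A -> S}) : Prop :=
  (forall s, eps s%:A = s) /\
  (forall n a, (0 < n)%N -> a \in gr n -> eps a = 0).

(* c_A; the set is nonempty when A is connected, since A^0 = S <> 0. *)
Definition complexity : \bar int :=
  supremum -oo%E
    [set ((n%:Z - 1)%:E)%E | n in [set n | exists2 a, a \in gr n & a != 0]].

End GradedRing.

Section TensorRing.
Variables (S : nzRingType) (A : lalgType S) (V : submodClosed A).

(* For V an S-subbimodule of A and B an S-ring: f is right S-linear. *)
Definition right_linear (B : lalgType S) (f : submod V -> B) : Prop :=
  forall (v w : submod V) (s : S), val w = val v * s%:A -> f w = f v * s%:A.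

Variables (T : lalgType S) (j : {linear submod V -> T}).

(* (T, j) is the tensor S-ring T_S(V): the S-ring freely generated by the
   S-bimodule V. *)
Definition is_tensor_ring : Prop :=
  [/\ right_linear j,
      forall (B : lalgType S) (f : {linear submod V -> B}), right_linear f ->
        exists g : {lrmorphism T -> B}, forall v, g (j v) = f v &
      forall (B : lalgType S) (g h : {lrmorphism T -> B}),
        (forall v, g (j v) = h (j v)) -> g =1 h].

(* The degree n component of T_S(V), i.e. the image of the n-th tensor power
   of V. *)
Fixpoint tensor_ring_deg (n : nat) : set T :=
  if n is n'.+1 then mulspan (range j) (tensor_ring_deg n')
  else range (in_alg T).

Definition is_canonical_map (pi : {lrmorphism T -> A}) : Prop :=
  forall v, pi (j v) = val v.

Definition relation_ideal (pi : {lrmorphism T -> A}) : set T :=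
  [set t | pi t = 0].

(* A^1 I_A + I_A A^1 *)
Definition decomposable_relations (pi : {lrmorphism T -> A}) : set T :=
  [set x + y | x in mulspan (range j) (relation_ideal pi)
             & y in mulspan (relation_ideal pi) (range j)].

Definition is_bimodule_of_relations (pi : {lrmorphism T -> A})
    (R : submodClosed T) : Prop :=
  [/\ (* R is a left S-submodule by its type, and a right one: *)
      forall r s, r \in R -> r * s%:A \in R,
      forall r, r \in R -> exists n (c : nat -> T),
        (forall i, c i \in R /\ tensor_ring_deg i (c i)) /\
        r = \sum_(i < n) c i,
      relation_ideal pi =
        [set x + y | x in [set` R] & y in decomposable_relations pi] &
      [set` R] `&` decomposable_relations pi = [set 0]].

End TensorRing.

Section Tensor.
Variables (A : nzRingType) (N : lmodType A^c) (M : lmodType A).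
Local Notation F := {freeg (N * M)%type / int}.

Inductive tensor_rel : F -> Prop :=
| TensorRel0 : tensor_rel 0
| TensorRelB u v : tensor_rel u -> tensor_rel v -> tensor_rel (u - v)
| TensorRelDl x y m :
    tensor_rel (<<(x + y, m)>> - (<<(x, m)>> + <<(y, m)>>))
| TensorRelDr x m p :
    tensor_rel (<<(x, m + p)>> - (<<(x, m)>> + <<(x, p)>>))
| TensorRelA x (a : A) m :
    tensor_rel (<<((a : A^c) *: x, m)>> - <<(x, a *: m)>>).

Definition tensor_relb : {pred F} := fun u => `[< tensor_rel u >].

Fact tensor_relb_closed : zmod_closed tensor_relb.
Proof.
split; first by apply/asboolP; exact: TensorRel0.
by move=> u v /asboolP hu /asboolP hv; apply/asboolP; exact: TensorRelB.
Qed.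

HB.instance Definition _ :=
  GRing.isZmodClosed.Build F tensor_relb tensor_relb_closed.

Definition tensor : Type := @Quotient.quot F tensor_relb.
HB.instance Definition _ := GRing.Zmodule.on tensor.
HB.instance Definition _ := EqQuotient.on tensor.

Definition pure (x : N) (m : M) : tensor := \pi_tensor <<(x, m)>>.

End Tensor.

Section TensorMap.
Variables (A : nzRingType) (N : lmodType A^c) (M M' : lmodType A).
Variable f : {linear M -> M'}.

Definition freeg_map (u : {freeg (N * M)%type / int}) :
    {freeg (N * M')%type / int} :=
  fglift (fun xm : N * M => <<(xm.1, f xm.2)>>) u.

Definition tensor_map (z : tensor N M) : tensor N M' :=
  \pi_(tensor N M') (freeg_map (repr z)).

Let freeg_mapB u v : freeg_map (u - v) = freeg_map u - freeg_map v.
Proof. exact: lift_is_additive. Qed.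

Let freeg_mapD u v : freeg_map (u + v) = freeg_map u + freeg_map v.
Proof.
have map0 : freeg_map 0 = 0 by rewrite -(subrr 0) freeg_mapB subrr.
have mapN w : freeg_map (- w) = - freeg_map w.
  by rewrite -(sub0r w) freeg_mapB map0 sub0r.
by rewrite -{1}(opprK v) freeg_mapB mapN opprK.
Qed.

Let freeg_map1 x m : freeg_map <<(x, m)>> = <<(x, f m)>>.
Proof. by rewrite /freeg_map liftU scale1r. Qed.

Let freeg_map_rel u : tensor_rel u -> tensor_rel (freeg_map u).
Proof.
elim=> [|v w _ IHv _ IHw|x y m|x m p|x a m].
- by rewrite -(subrr 0) freeg_mapB subrr; exact: TensorRel0.
- by rewrite freeg_mapB; exact: TensorRelB.
- by rewrite freeg_mapB freeg_mapD !freeg_map1; exact: TensorRelDl.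
- by rewrite freeg_mapB freeg_mapD !freeg_map1 linearD; exact: TensorRelDr.
- by rewrite freeg_mapB !freeg_map1 linearZ_LR; exact: TensorRelA.
Qed.

Let eq_tensor (L : lmodType A) (u v : {freeg (N * L)%type / int}) :
  \pi_(tensor N L) u = \pi_(tensor N L) v <-> tensor_rel (u - v).
Proof.
split=> [/eqP|h]; last apply/eqP.
  by rewrite -Quotient.idealrBE => /asboolP.
by rewrite -Quotient.idealrBE; apply/asboolP.
Qed.

Let piB (L : lmodType A) (u v : {freeg (N * L)%type / int}) :
  \pi_(tensor N L) (u - v) = \pi_(tensor N L) u - \pi_(tensor N L) v.
Proof. by rewrite Quotient.pi_add Quotient.pi_opp. Qed.

Let tensor_map_pi u :
  tensor_map (\pi_(tensor N M) u) = \pi_(tensor N M') (freeg_map u).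
Proof.
apply/eq_tensor; rewrite -freeg_mapB; apply/freeg_map_rel/eq_tensor.
by rewrite reprK.
Qed.

Lemma tensor_map_pure x m : tensor_map (pure x m) = pure x (f m).
Proof. by rewrite /pure tensor_map_pi freeg_map1. Qed.

Fact tensor_map_is_zmod_morphism : zmod_morphism tensor_map.
Proof.
move=> y z; rewrite -[y]reprK -[z]reprK -piB !tensor_map_pi.
by rewrite freeg_mapB piB.
Qed.

HB.instance Definition _ := GRing.isZmodMorphism.Build
  (tensor N M) (tensor N M') tensor_map tensor_map_is_zmod_morphism.

End TensorMap.

(* S as a left and as a right A-module, through an augmentation A -> S. *)
Section Augmentation.
Variables (S A : nzRingType).

Definition aug_lmod (eps : {rmorphism A -> S}) : Type := S.
Definition aug_rmod (eps : {rmorphism A -> S}) : Type := S.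

Variable eps : {rmorphism A -> S}.
HB.instance Definition _ := GRing.Zmodule.copy (aug_lmod eps) S.
HB.instance Definition _ := GRing.Zmodule.copy (aug_rmod eps) S.

Let lscale (a : A) (s : aug_lmod eps) : aug_lmod eps := eps a * (s : S).
Let rscale (a : A^c) (s : aug_rmod eps) : aug_rmod eps := (s : S) * eps a.

Fact aug_lscaleA a b s : lscale a (lscale b s) = lscale (a * b) s.
Proof. by rewrite /lscale rmorphM mulrA. Qed.
Fact aug_lscale1 : left_id 1 lscale.
Proof. by move=> s; rewrite /lscale rmorph1 mul1r. Qed.
Fact aug_lscaleDr : right_distributive lscale +%R.
Proof. by move=> a s t; rewrite /lscale mulrDr. Qed.
Fact aug_lscaleDl s : {morph lscale^~ s : a b / a + b}.
Proof. by move=> a b; rewrite /lscale rmorphD mulrDl. Qed.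

Fact aug_rscaleA a b s : rscale a (rscale b s) = rscale (a * b) s.
Proof. by rewrite /rscale -mulrA -rmorphM. Qed.
Fact aug_rscale1 : left_id 1 rscale.
Proof. by move=> s; rewrite /rscale rmorph1 mulr1. Qed.
Fact aug_rscaleDr : right_distributive rscale +%R.
Proof. by move=> a s t; rewrite /rscale mulrDl. Qed.
Fact aug_rscaleDl s : {morph rscale^~ s : a b / a + b}.
Proof. by move=> a b; rewrite /rscale rmorphD mulrDr. Qed.

HB.instance Definition _ := GRing.Zmodule_isLmodule.Build A (aug_lmod eps)
  aug_lscaleA aug_lscale1 aug_lscaleDr aug_lscaleDl.
HB.instance Definition _ := GRing.Zmodule_isLmodule.Build A^c (aug_rmod eps)
  aug_rscaleA aug_rscale1 aug_rscaleDr aug_rscaleDl.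
End Augmentation.

Section Tor.
Variables (S : nzRingType) (A : lalgType S) (gr : nat -> submodClosed A).
Variable eps : {rmorphism A -> S}.

(* ... -> P_1 -> P_0 -> S -> 0, a resolution of S by graded left A-modules that
   are projective, with maps of degree 0; S is concentrated in degree 0. *)
Record graded_projective_resolution := GradedProjectiveResolution {
  res_mod :> nat -> lmodType A;
  res_gr : forall i, nat -> zmodClosed (res_mod i);
  res_d : forall i, {linear res_mod i.+1 -> res_mod i};
  res_aug : {linear res_mod 0 -> aug_lmod eps};
  res_direct_sum : forall i, is_direct_sum (res_gr i);
  res_graded : forall i n m (a : A) (p : res_mod i),
    a \in gr n -> p \in res_gr i m -> a *: p \in res_gr i (n + m)%N;
  res_projective : forall i, projective (res_mod i);
  res_d_homogeneous : forall i n (p : res_mod i.+1),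
    p \in res_gr i.+1 n -> res_d i p \in res_gr i n;
  res_aug_homogeneous : forall n (p : res_mod 0),
    (0 < n)%N -> p \in res_gr 0 n -> res_aug p = 0;
  res_aug_surjective : forall s, exists p, res_aug p = s;
  res_exact0 : forall p, res_aug p = 0 <-> exists q, res_d 0 q = p;
  res_exact : forall i p, res_d i p = 0 <-> exists q, res_d i.+1 q = p
}.

Variable P : graded_projective_resolution.

(* The complex S (x)_A P, whose homology is Tor^A(S,S): Tor^A(S,-) is taken as
   the left derived functor of S (x)_A -. *)
Definition tor_complex (i : nat) : zmodType := tensor (aug_rmod eps) (P i).

Definition tor_d (i : nat) : tor_complex i.+1 -> tor_complex i :=
  tensor_map (res_d P i).

(* The component of internal degree n, the left factor S being in degree 0. *)
Definition tor_complex_deg (i n : nat) : set (tor_complex i) :=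
  [set z | exists s : seq (S * P i),
     (forall u, u \in s -> u.2 \in res_gr P i n) /\
     z = \sum_(u <- s) pure (u.1 : aug_rmod eps) u.2].

Definition tor_cycle (i : nat) : set (tor_complex i) :=
  if i is i'.+1 then [set z | tor_d z = 0] else [set: tor_complex 0].

Definition tor_eq0 (i : nat) : Prop :=
  @tor_cycle i `<=` [set tor_d z | z in [set: tor_complex i.+1]].

(* Tor_{i,n}^A(S,S) = 0, Tor_{i,n} being the homology of the degree n part. *)
Definition tor_deg_eq0 (i n : nat) : Prop :=
  @tor_cycle i `&` @tor_complex_deg i n
    `<=` [set tor_d z | z in @tor_complex_deg i.+1 n].

Definition homological_complexity : \bar int :=
  if `[< tor_eq0 3 >] then (-1)%:E%E
  else supremum -oo%E
    [set ((n%:Z - 1)%:E)%E | n in [set n | ~ tor_deg_eq0 3 n]].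

End Tor.

(* Main.v *)
Require Import Defs.
From HB Require Import structures.
From mathcomp Require Import all_boot all_order all_algebra.
From mathcomp Require Import generic_quotient ring_quotient.
From mathcomp Require Import boolp classical_sets constructive_ereal.
From mathcomp Require Import freeg zify.

Set Implicit Arguments.
Unset Strict Implicit.
Unset Printing Implicit Defensive.
Import Order.TTheory GRing.Theory Num.Theory.
Local Open Scope ring_scope.
Local Open Scope quotient_scope.

(** Write A = T / I with T = T_S(A^1), and let del : T -> A (x)_S A^1 be the Fox
    derivation, del (t u) = pi t del u + del t eps (pi u), del v = 1 (x) v.  Then
       A (x)_S R --d2--> A (x)_S A^1 --d1--> A --eps--> S -> 0,
    with d2 (a (x) r) = a del r and d1 (a (x) v) = a v, is exact: exactness at
    A (x)_S A^1 is a graded Nakayama argument using I = R + A^1 I + I A^1.  As A^1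
    and R are projective over S, this is the beginning of a projective resolution
    Q of S, and it can be compared with the given resolution P.

    Let d be the top degree of A.  Elements of T of degree m > d lie in I, hence
    R lives in degrees <= d + 1, and del vanishes on T^m for m >= d + 2, so that
    d2 = 0 in degrees >= d + 2.  Hence in degrees n >= d + 3 every element of
    A (x)_S R is a sum of products v z with v in A^1 and z in ker d2, and
    Tor_{3,n} = 0.

    With chain maps f : P -> Q and g : Q -> P and a homotopy h from g f to 1, a
    boundary x = d p of degree n in A_+ P_2 is g (f x) - d (h x), with h x in
    A_+ P_3; only g has to be homogeneous. *)

(** * Tensor products *)

Section TensorUniversal.
Variables (A : nzRingType) (N : lmodType A^c) (M : lmodType A).
Local Notation F := {freeg (N * M)%type / int}.

Lemma eq_tensor (u v : F) :
  \pi_(tensor N M) u = \pi_(tensor N M) v <-> tensor_rel (u - v).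
Proof.
split=> [/eqP|h]; last apply/eqP.
  by rewrite -Quotient.idealrBE => /asboolP.
by rewrite -Quotient.idealrBE; apply/asboolP.
Qed.

Lemma pi_tensorB (u v : F) :
  \pi_(tensor N M) (u - v) = \pi_(tensor N M) u - \pi_(tensor N M) v.
Proof. by rewrite Quotient.pi_add Quotient.pi_opp. Qed.

Lemma pi_tensor0 : \pi_(tensor N M) (0 : F) = 0.
Proof. by rewrite -(subrr 0) pi_tensorB subrr. Qed.

Lemma pureDl x y m : pure (x + y) m = pure x m + pure y m :> tensor N M.
Proof.
rewrite /pure -[in RHS](opprK (\pi_(tensor N M) <<(y, m)>>)).
rewrite -[- \pi_(tensor N M) _]sub0r -pi_tensor0 -!pi_tensorB.
by apply/eq_tensor; rewrite sub0r !opprK; exact: TensorRelDl.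
Qed.

Lemma pureDr x m p : pure x (m + p) = pure x m + pure x p :> tensor N M.
Proof.
rewrite /pure -[in RHS](opprK (\pi_(tensor N M) <<(x, p)>>)).
rewrite -[- \pi_(tensor N M) _]sub0r -pi_tensor0 -!pi_tensorB.
by apply/eq_tensor; rewrite sub0r !opprK; exact: TensorRelDr.
Qed.

Lemma pureA x (a : A) m : pure ((a : A^c) *: x) m = pure x (a *: m) :> tensor N M.
Proof. by apply/eq_tensor; exact: TensorRelA. Qed.

Lemma pure0l m : pure 0 m = 0 :> tensor N M.
Proof. by apply: (@addrI _ (pure 0 m)); rewrite -pureDl !addr0. Qed.

Lemma pure0r x : pure x 0 = 0 :> tensor N M.
Proof. by apply: (@addrI _ (pure x 0)); rewrite -pureDr !addr0. Qed.

(** Closure under differences already gives 0, opposites and sums. An element of the free group is a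
    sum of integer multiples of generators, so only the sign of each coefficient has to be
    treated. *)
Lemma tensor_ind (Pr : tensor N M -> Prop) :
  (forall x m, Pr (pure x m)) -> (forall y z, Pr y -> Pr z -> Pr (y - z)) ->
  forall z, Pr z.
Proof.
move=> Pp PB z; have P0 : Pr 0 by rewrite -(subrr (pure 0 0)); apply: PB.
have PN y : Pr y -> Pr (- y) by rewrite -sub0r; apply: PB.
have PD x y : Pr x -> Pr y -> Pr (x + y).
  by move=> Px /PN /(PB _ _ Px); rewrite opprK.
have piD (u v : F) : \pi_(tensor N M) (u + v) = \pi u + \pi v.
  by rewrite Quotient.pi_add.
rewrite -[z]reprK -(freeg_sumE (repr z)).
apply: (big_ind (fun u : F => Pr (\pi_(tensor N M) u))).
- by rewrite pi_tensor0.
- by move=> u v Pu Pv; rewrite piD; apply: PD.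
move=> [x m] _; rewrite -[coeff _ _]intz -freegU_mulz.
have Pn n : Pr (\pi_(tensor N M) (<<(x, m)>> *+ n)).
  elim: n => [|n IHn]; first by rewrite mulr0n pi_tensor0.
  by rewrite mulrS piD; apply: PD => //; exact: Pp.
case: (coeff _ _) => n; rewrite ?NegzE ?mulrNz -pmulrn //.
by rewrite -[- _]sub0r pi_tensorB pi_tensor0 sub0r; apply: PN.
Qed.

Section Lift.
Variables (G : zmodType) (phi : N -> M -> G).

Definition freeg_lift (u : F) : G := fglift (fun xm => phi xm.1 xm.2 : zmodule G) u.

Lemma freeg_liftB u v : freeg_lift (u - v) = freeg_lift u - freeg_lift v.
Proof. exact: (@lift_is_additive int _ (zmodule G) _ u v). Qed.

Lemma freeg_lift0 : freeg_lift 0 = 0.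
Proof. by have := freeg_liftB 0 0; rewrite !subrr. Qed.

Lemma freeg_liftD u v : freeg_lift (u + v) = freeg_lift u + freeg_lift v.
Proof.
by rewrite -{1}(opprK v) freeg_liftB -[- v]sub0r freeg_liftB freeg_lift0 sub0r opprK.
Qed.

Lemma freeg_liftU x m : freeg_lift <<(x, m)>> = phi x m.
Proof. by rewrite /freeg_lift (@liftU _ (zmodule G)) scale1r. Qed.

(** The target predicate [H] is kept general because two are used: being 0, which gives the
    universal property, and lying in A_+ M, for maps that are balanced only modulo that subgroup. *)
Lemma freeg_lift_rel (H : G -> Prop) (u : F) :
  H 0 -> (forall x y, H x -> H y -> H (x - y)) ->
  (forall x y m, H (phi (x + y) m - (phi x m + phi y m))) ->
  (forall x m p, H (phi x (m + p) - (phi x m + phi x p))) ->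
  (forall x (a : A) m, H (phi ((a : A^c) *: x) m - phi x (a *: m))) ->
  tensor_rel u -> H (freeg_lift u).
Proof.
move=> H0 HB HDl HDr HA; elim=> [|v w _ IHv _ IHw|x y m|x m p|x a m].
- by rewrite freeg_lift0.
- by rewrite freeg_liftB; apply: HB.
- by rewrite freeg_liftB freeg_liftD !freeg_liftU; exact: HDl.
- by rewrite freeg_liftB freeg_liftD !freeg_liftU; exact: HDr.
- by rewrite freeg_liftB !freeg_liftU; exact: HA.
Qed.

Hypothesis phiDl : forall x y m, phi (x + y) m = phi x m + phi y m.
Hypothesis phiDr : forall x m p, phi x (m + p) = phi x m + phi x p.
Hypothesis phiA : forall x (a : A) m, phi ((a : A^c) *: x) m = phi x (a *: m).

(** The universal property of the tensor product. The map is computed on a chosen representative;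
    [freeg_lift_rel] shows that the choice does not matter. *)
Lemma tensor_lift_exists : exists f : {additive tensor N M -> G},
  forall x m, f (pure x m) = phi x m.
Proof.
pose f (z : tensor N M) := freeg_lift (repr z).
have fpi u : f (\pi u) = freeg_lift u.
  apply/eqP; rewrite -subr_eq0 -freeg_liftB; apply/eqP.
  apply: (@freeg_lift_rel (eq^~ 0)) => //; rewrite ?subrr //.
  - by move=> x y -> ->; rewrite subrr.
  - by move=> x y m; rewrite phiDl subrr.
  - by move=> x m p; rewrite phiDr subrr.
  - by move=> x a m; rewrite phiA subrr.
  - by apply/eq_tensor; rewrite reprK.
have fB : zmod_morphism f.
  by move=> y z; rewrite -[y]reprK -[z]reprK -pi_tensorB !fpi freeg_liftB.
pose fm := GRing.isZmodMorphism.Build _ _ f fB.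
pose fa : {additive tensor N M -> G} := HB.pack f fm.
by exists fa => x m; rewrite /= fpi freeg_liftU.
Qed.

End Lift.
End TensorUniversal.

(** * Lifting along projectives and induced modules *)

Section LinearImage.
Variables (A : pzRingType) (M N : lmodType A) (g : {linear M -> N}).

Definition linear_image : {pred N} := fun y => `[< exists x, g x = y >].

Fact linear_image_closed : submod_closed linear_image.
Proof.
split; first by apply/asboolP; exists 0; rewrite linear0.
move=> a y z /asboolP[x1 <-] /asboolP[x2 <-].
by apply/asboolP; exists (a *: x1 + x2); rewrite linearP.
Qed.
HB.instance Definition _ :=
  GRing.isSubmodClosed.Build A N linear_image linear_image_closed.

(** Both maps are corestricted to the image of g, where g becomes onto. This is the form in which
    exactness is used: f only has to land in that image. *)
Lemma projective_lift (P : lmodType A) (f : {linear P -> N}) :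
  projective P -> (forall p, exists x, g x = f p) ->
  exists h : {linear P -> M}, forall p, g (h p) = f p.
Proof.
move=> projP fg.
have im_g x : g x \in linear_image by apply/asboolP; exists x.
have im_f p : f p \in linear_image by apply/asboolP; exact: fg.
pose g' x : submod linear_image := Submod (im_g x).
pose f' p : submod linear_image := Submod (im_f p).
have lin_g' : linear g' by move=> a x y; apply: val_inj; rewrite /= linearP.
have lin_f' : linear f' by move=> a x y; apply: val_inj; rewrite /= linearP.
pose mg := GRing.isLinear.Build _ _ _ _ g' lin_g'.
pose mf := GRing.isLinear.Build _ _ _ _ f' lin_f'.
pose Lg : {linear M -> submod linear_image} := HB.pack g' mg.
pose Lf : {linear P -> submod linear_image} := HB.pack f' mf.
have [|h hP] := projP _ _ Lg Lf.
  by case=> y yP; have /asboolP[x gx] := yP; exists x; apply: val_inj.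
by exists h => p; have := congr1 val (hP p).
Qed.
End LinearImage.

Section RestrictionOfScalars.
Variables (S : nzRingType) (A : lalgType S) (M : lmodType A).

(** An alias, so that the S-module structure does not compete with the A-module structure on the
    same carrier. *)
Definition restr : Type := M.
HB.instance Definition _ := GRing.Zmodule.copy restr M.

Let scale (s : S) (m : restr) : restr := s%:A *: (m : M).
Fact restr_scaleA a b s : scale a (scale b s) = scale (a * b) s.
Proof. by rewrite /scale scalerA -scalerAl mul1r scalerA. Qed.
Fact restr_scale1 : left_id 1 scale.
Proof. by move=> s; rewrite /scale !scale1r. Qed.
Fact restr_scaleDr : right_distributive scale +%R.
Proof. by move=> a s t; rewrite /scale scalerDr. Qed.
Fact restr_scaleDl s : {morph scale^~ s : a b / a + b}.
Proof. by move=> a b; rewrite /scale scalerDl scalerDl. Qed.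
HB.instance Definition _ := GRing.Zmodule_isLmodule.Build S restr
  restr_scaleA restr_scale1 restr_scaleDr restr_scaleDl.

Lemma restrZ (s : S) (m : restr) : s *: m = s%:A *: (m : M).
Proof. by []. Qed.
End RestrictionOfScalars.

Section RightRegular.
Variables (S : nzRingType) (A : lalgType S).

Definition rreg : Type := A.
HB.instance Definition _ := GRing.Zmodule.copy rreg A.

Let scale (s : S^c) (a : rreg) : rreg := (a : A) * (s : S)%:A.
Fact rreg_scaleA a b s : scale a (scale b s) = scale (a * b) s.
Proof. by rewrite /scale -mulrA -scalerAl mul1r scalerA. Qed.
Fact rreg_scale1 : left_id 1 scale.
Proof. by move=> s; rewrite /scale scale1r mulr1. Qed.
Fact rreg_scaleDr : right_distributive scale +%R.
Proof. by move=> a s t; rewrite /scale mulrDl. Qed.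
Fact rreg_scaleDl s : {morph scale^~ s : a b / a + b}.
Proof. by move=> a b; rewrite /scale scalerDl mulrDr. Qed.
HB.instance Definition _ := GRing.Zmodule_isLmodule.Build S^c rreg
  rreg_scaleA rreg_scale1 rreg_scaleDr rreg_scaleDl.

Lemma rregZ (s : S^c) (a : rreg) : s *: a = (a : A) * (s : S)%:A.
Proof. by []. Qed.
End RightRegular.

Section Induced.
Variables (S : nzRingType) (A : lalgType S) (L : lmodType S).

(** The induced left A-module A (x)_S L, with A acting on the left factor. *)
Definition induced : Type := tensor (rreg A) L.
HB.instance Definition _ := GRing.Zmodule.copy induced (tensor (rreg A) L).

Definition ipure (a : A) (l : L) : induced := pure (a : rreg A) l.

Fact induced_scale_exists (a : A) : exists f : {additive tensor (rreg A) L -> induced},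
  forall x l, f (pure x l) = ipure (a * (x : A)) l.
Proof.
apply: tensor_lift_exists => [x y m|x m p|x s m].
- by rewrite /ipure mulrDr pureDl.
- by rewrite /ipure pureDr.
- by rewrite /ipure -pureA !rregZ mulrA.
Qed.

Definition induced_scale (a : A) (z : induced) : induced :=
  sval (cid (induced_scale_exists a)) z.

Lemma induced_scaleE a x l : induced_scale a (ipure x l) = ipure (a * x) l.
Proof. by rewrite /induced_scale; case: cid => f /= ->. Qed.

Fact induced_scaleB a : {morph induced_scale a : x y / x - y}.
Proof. by move=> x y; rewrite /induced_scale raddfB. Qed.
Fact induced_scaleDr : right_distributive induced_scale +%R.
Proof. by move=> a s t; rewrite /induced_scale raddfD. Qed.
Fact induced_scaleA a b z :
  induced_scale a (induced_scale b z) = induced_scale (a * b) z.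
Proof.
elim/tensor_ind: z => [x l|y z IHy IHz]; first by rewrite !induced_scaleE mulrA.
by rewrite !induced_scaleB IHy IHz.
Qed.
Fact induced_scale1 : left_id 1 induced_scale.
Proof.
elim/tensor_ind => [x l|y z IHy IHz]; first by rewrite !induced_scaleE mul1r.
by rewrite !induced_scaleB IHy IHz.
Qed.
Fact induced_scaleDl z : {morph induced_scale^~ z : a b / a + b}.
Proof.
move=> a b; elim/tensor_ind: z => [x l|y z IHy IHz].
  by rewrite !induced_scaleE mulrDl /ipure pureDl.
by rewrite !induced_scaleB IHy IHz opprD addrACA.
Qed.
HB.instance Definition _ := GRing.Zmodule_isLmodule.Build A induced
  induced_scaleA induced_scale1 induced_scaleDr induced_scaleDl.

Lemma ipureZ a x l : a *: ipure x l = ipure (a * x) l.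
Proof. exact: induced_scaleE. Qed.
Lemma ipureDl x y l : ipure (x + y) l = ipure x l + ipure y l.
Proof. exact: (@pureDl _ (rreg A) L x y l). Qed.
Lemma ipureDr x l m : ipure x (l + m) = ipure x l + ipure x m.
Proof. exact: (@pureDr _ (rreg A) L x l m). Qed.
Lemma ipureA x s l : ipure (x * s%:A) l = ipure x (s *: l).
Proof. exact: (@pureA _ (rreg A) L x s l). Qed.
Lemma ipure0l l : ipure 0 l = 0.
Proof. exact: (@pure0l _ (rreg A) L l). Qed.
Lemma ipure0r x : ipure x 0 = 0.
Proof. exact: (@pure0r _ (rreg A) L x). Qed.
Lemma ipureE x l : ipure x l = x *: ipure 1 l.
Proof. by rewrite ipureZ mulr1. Qed.

Lemma induced_ind (Pr : induced -> Prop) :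
  (forall x l, Pr (ipure x l)) -> (forall y z, Pr y -> Pr z -> Pr (y - z)) ->
  forall z, Pr z.
Proof. exact: (@tensor_ind _ (rreg A) L Pr). Qed.

(** Induction is left adjoint to restriction. Lifting problems for maps out of A (x)_S L are thereby
    solved on L, where projectivity is assumed. *)
Lemma induced_extension (M : lmodType A) (f : {linear L -> restr M}) :
  exists g : {linear induced -> M}, forall x l, g (ipure x l) = x *: (f l : M).
Proof.
have [|||g0 g0E] := @tensor_lift_exists _ (rreg A) L M
    (fun x l => (x : A) *: (f l : M)).
- by move=> x y m; rewrite scalerDl.
- by move=> x y m; rewrite linearD scalerDr.
- by move=> x s m; rewrite linearZ_LR rregZ restrZ scalerA.
pose g (z : induced) : M := g0 z.
have gE x l : g (ipure x l) = x *: (f l : M) by exact: g0E.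
have gB y z : g (y - z) = g y - g z by exact: raddfB.
have lin_g : linear g.
  move=> a y z; have -> : g (a *: y + z) = g (a *: y) + g z by exact: raddfD.
  congr (_ + _); elim/induced_ind: y => [x l|y y' IHy IHy'].
    by rewrite ipureZ !gE scalerA.
  by rewrite scalerBr !gB IHy IHy' scalerBr.
pose mg := GRing.isLinear.Build _ _ _ _ g lin_g.
by exists (HB.pack_for {linear induced -> M} g mg).
Qed.

Lemma induced_ext (M : lmodType A) (f g : {linear induced -> M}) :
  (forall l, f (ipure 1 l) = g (ipure 1 l)) -> f =1 g.
Proof.
move=> fg; elim/induced_ind => [x l|y z IHy IHz].
  by rewrite ipureE !linearZ fg.
by rewrite !linearB IHy IHz.
Qed.

Lemma induced_gen_linear : linear (ipure 1 : L -> restr induced).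
Proof.
move=> s l m; rewrite ipureDr; congr (_ + _).
by rewrite restrZ -ipureA mul1r ipureZ mulr1.
Qed.

Lemma restr_linear (M : lmodType A) (f : {linear induced -> M}) :
  exists h : {linear L -> restr M}, forall l, h l = f (ipure 1 l).
Proof.
pose h (l : L) : restr M := f (ipure 1 l).
have lin_h : linear h.
  by move=> s l m; rewrite /h induced_gen_linear linearP.
pose mh := GRing.isLinear.Build _ _ _ _ h lin_h.
by exists (HB.pack_for {linear L -> restr M} h mh).
Qed.

End Induced.
Arguments ipure {S A L}.

(** * Homogeneous components *)

Section Component.
Variables (V : zmodType) (gr : nat -> {pred V}).

(** Reads the n-th term of some decomposition of v, extended by 0 beyond its length. The default of
    [xget] is not reached when the grading is a direct sum. *)
Definition component (n : nat) (v : V) : V :=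
  xget 0 [set x | exists N (c : nat -> V), [/\ forall i, c i \in gr i,
    v = \sum_(i < N) c i & x = if (n < N)%N then c n else 0]]%classic.

Hypothesis gr_closed : forall n, zmod_closed (gr n).
Hypothesis gr_sum : is_direct_sum gr.

Let gr0 n : 0 \in gr n. Proof. by have [] := gr_closed n. Qed.
Let grB n : {in gr n &, forall x y, x - y \in gr n}.
Proof. by have [_ B] := gr_closed n; exact: B. Qed.

Let widen (c : nat -> V) N K : (N <= K)%N ->
  \sum_(i < N) c i = \sum_(i < K) (if (i < N)%N then c i else 0).
Proof.
move=> NK; rewrite (big_ord_widen K (fun i => c i) NK) [LHS]big_mkcond.
by apply: eq_bigr.
Qed.

(** The decomposition chosen by [component] may differ in length from c. Padded with zeros to a
    common length, the two are equal by directness of the sum. *)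
Lemma componentE n N (c : nat -> V) : (forall i, c i \in gr i) ->
  component n (\sum_(i < N) c i) = if (n < N)%N then c n else 0.
Proof.
move=> cgr; rewrite /component.
case: xgetP => [y _|/(_ (if (n < N)%N then c n else 0))]; last first.
  by case; exists N, c.
case=> N' [c' [c'gr eq_sum ->]].
set e := fun (M : nat) (b : nat -> V) i => if (i < M)%N then b i else 0.
have egr M b : (forall i, b i \in gr i) -> forall i, e M b i \in gr i.
  by move=> bgr i; rewrite /e; case: ifP.
have [nK|] := ltnP n (maxn N N'); last first.
  by rewrite geq_max => /andP[/leq_gtF -> /leq_gtF ->].
apply/eqP; rewrite -subr_eq0; apply/eqP.
apply: (gr_sum.2 (maxn N N') (fun i => e N' c' i - e N c i)) => //.
  by move=> i; apply: grB; apply: egr.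
by rewrite sumrB -(widen _ (leq_maxl N N')) -(widen _ (leq_maxr N N')) -eq_sum subrr.
Qed.

Lemma component_in n v : component n v \in gr n.
Proof.
have [N [c [cgr ->]]] := gr_sum.1 v; rewrite componentE //.
by case: ifP.
Qed.

(** Every large enough M is allowed, so that several elements can be expanded over one common
    range. *)
Lemma component_bound v :
  exists N, forall M, (N <= M)%N -> v = \sum_(i < M) component i v.
Proof.
have [N [c [cgr ->]]] := gr_sum.1 v; exists N => M NM; rewrite (widen _ NM).
by apply: eq_bigr => i _; rewrite -(widen _ NM) componentE.
Qed.

Lemma componentB n : {morph component n : x y / x - y}.
Proof.
move=> x y; have [N1 hx] := component_bound x; have [N2 hy] := component_bound y.
have {}hx := hx _ (leq_trans (leq_maxl _ n.+1) (leq_maxl _ (maxn N2 n.+1))).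
have {}hy := hy _ (leq_trans (leq_maxl _ n.+1) (leq_maxr (maxn N1 n.+1) _)).
rewrite {1}hx {1}hy -sumrB.
rewrite (componentE _ _ (c := fun i => component i x - component i y)).
  by rewrite leq_max (leq_maxr N1).
by move=> i; apply: grB; exact: component_in.
Qed.

Lemma component0 n : component n 0 = 0.
Proof. by have := componentB n 0 0; rewrite !subrr. Qed.

Lemma componentD n : {morph component n : x y / x + y}.
Proof.
move=> x y; rewrite -[y in LHS]opprK componentB -[- y]sub0r componentB component0.
by rewrite sub0r opprK.
Qed.

Lemma component_sumr n (I : Type) (s : seq I) (F : I -> V) :
  component n (\sum_(i <- s) F i) = \sum_(i <- s) component n (F i).
Proof. exact: (big_morph _ (componentD n) (component0 n)). Qed.

Lemma component_homogeneous n m v :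
  v \in gr m -> component n v = if n == m then v else 0.
Proof.
move=> vm; pose c i := if i == m then v else 0.
have cgr i : c i \in gr i by rewrite /c; case: eqP => [->|].
have vE : v = \sum_(i < (maxn m n).+1) c i.
  rewrite -(big_mkord xpredT c) (bigD1_seq m) ?iota_uniq //=.
    by rewrite {1}/c eqxx big1 ?addr0 // => i /negPf; rewrite /c => ->.
  by rewrite mem_index_iota /= ltnS leq_maxl.
by rewrite {1}vE componentE // ltnS leq_maxr.
Qed.

End Component.

Lemma component_morph (V W : zmodType) (grV : nat -> {pred V}) (grW : nat -> {pred W})
    (f : V -> W) n v :
  (forall n, zmod_closed (grV n)) -> is_direct_sum grV ->
  (forall n, zmod_closed (grW n)) -> is_direct_sum grW ->
  zmod_morphism f -> (forall n v, v \in grV n -> f v \in grW n) ->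
  component grW n (f v) = f (component grV n v).
Proof.
move=> cV dV cW dW fB fgr.
pose mf := GRing.isZmodMorphism.Build _ _ f fB.
pose F : {additive V -> W} := HB.pack f mf.
have fE : f = F by [].
have [N hN] := component_bound cV dV v.
rewrite {1}(hN (maxn N n.+1)) ?leq_maxl // fE raddf_sum -fE.
rewrite (componentE cW dW _ _ (c := fun i => f (component grV i v))) ?leq_maxr //.
by move=> i; apply/fgr/component_in.
Qed.

(** The subgroup A_+ M generated by the products a m with a in the kernel of eps. *)
Inductive aug_part (S : nzRingType) (A : lalgType S) (eps : {rmorphism A -> S})
    (M : lmodType A) : M -> Prop :=
| AugPart0 : aug_part eps 0
| AugPartB x y : aug_part eps x -> aug_part eps y -> aug_part eps (x - y)
| AugPartZ a m : eps a = 0 -> aug_part eps (a *: m).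

Lemma aug_part_linear (S : nzRingType) (A : lalgType S) (eps : {rmorphism A -> S})
    (M M' : lmodType A) (f : {linear M -> M'}) m :
  aug_part eps m -> aug_part eps (f m).
Proof.
elim=> [|x y _ IHx _ IHy|a {}m ea].
- by rewrite linear0; exact: AugPart0.
- by rewrite linearB; exact: AugPartB.
- by rewrite linearZ; exact: AugPartZ.
Qed.

Section GradedModule.
Variables (S : nzRingType) (A : lalgType S) (gr : nat -> submodClosed A).
Hypothesis grA : is_graded_ring gr.

Lemma gr_ring_sum : is_direct_sum gr. Proof. by case: grA. Qed.

Lemma gr_ring_closed n : zmod_closed (gr n).
Proof. exact/GRing.submod_closedB/GRing.submodClosedP. Qed.

Variables (M : lmodType A) (grM : nat -> zmodClosed M).
Hypothesis sumM : is_direct_sum grM.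
Hypothesis actM : forall n m (a : A) p,
  a \in gr n -> p \in grM m -> a *: p \in grM (n + m)%N.

Let closedM n : zmod_closed (grM n). Proof. exact: zmodClosedP. Qed.

Lemma component_scale k m (a : A) p : a \in gr k ->
  component grM m (a *: p) = if (m < k)%N then 0 else a *: component grM (m - k) p.
Proof.
move=> ak; have [N hN] := component_bound closedM sumM p.
rewrite {1}(hN (maxn N m.+1)) ?leq_maxl // scaler_sumr component_sumr //.
under eq_bigr => i _.
  rewrite (component_homogeneous closedM sumM m (actM ak (component_in closedM sumM i p))).
  over.
case: ltnP => [mk|km].
  by rewrite big1 // => i _; case: eqP => // mE; have := leq_addr i k; rewrite -mE leqNgt mk.
have lt_m : (m - k < maxn N m.+1)%N.
  by rewrite leq_max ltnS leq_subr orbT.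
rewrite (bigD1 (Ordinal lt_m)) //= subnKC // eqxx big1 ?addr0 // => i.
rewrite -val_eqE /= => im; case: eqP => // mE; case/eqP: im.
by have := addKn k i; rewrite -mE.
Qed.

Variable eps : {rmorphism A -> S}.
Hypothesis epsA : is_augmentation gr eps.

(** The augmentation kills positive degrees, so eps a is the value of eps on the degree 0 component
    alone: the kernel of eps is a graded ideal. *)
Lemma aug_component a n : eps a = 0 -> eps (component gr n a) = 0.
Proof.
case: n => [|n] ea; last first.
  by rewrite (epsA.2 n.+1) //; apply: (component_in gr_ring_closed gr_ring_sum).
have [N hN] := component_bound gr_ring_closed gr_ring_sum a.
move: ea; rewrite {1}(hN N.+1) // big_ord_recl raddfD raddf_sum big1 ?addr0 //.
move=> i _; apply: (epsA.2 i.+1) => //.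
exact: (component_in gr_ring_closed gr_ring_sum).
Qed.

Lemma aug_partD (x y : M) : aug_part eps x -> aug_part eps y -> aug_part eps (x + y).
Proof.
move=> hx hy; rewrite -[y]opprK -[- y]sub0r; apply: AugPartB => //.
by apply: AugPartB => //; exact: AugPart0.
Qed.

Lemma aug_part_component n (m : M) : aug_part eps m -> aug_part eps (component grM n m).
Proof.
elim=> [|x y _ IHx _ IHy|a {}m ea].
- by rewrite component0 //; exact: AugPart0.
- by rewrite componentB //; exact: AugPartB.
have [N hN] := component_bound gr_ring_closed gr_ring_sum a.
rewrite (hN N) // scaler_suml component_sumr //.
apply: big_ind => [||i _]; [exact: AugPart0|exact: aug_partD|].
rewrite (@component_scale i) ?(component_in gr_ring_closed gr_ring_sum) //.
case: ifP => _; first exact: AugPart0.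
by apply: AugPartZ; apply: aug_component.
Qed.

Local Notation pure1 := (pure (1 : aug_rmod eps)).

Lemma pureE_aug (s : aug_rmod eps) (m : M) : pure s m = pure1 ((s : S)%:A *: m).
Proof.
rewrite -pureA; congr pure.
by have := epsA.1 s; rewrite /GRing.scale /= => ->; rewrite mul1r.
Qed.

(** This identifies S (x)_A M with M / A_+ M. For the direct implication, (s, m) is sent to s m in
    M: the relations of the tensor product need not go to 0, but they go into A_+ M. *)
Lemma pure1_aug_eq0 (m : M) : pure1 m = 0 <-> aug_part eps m.
Proof.
split=> [h|]; last first.
  elim=> [|x y _ IHx _ IHy|a {}m ea].
  - exact: pure0r.
  - have := pureDr (1 : aug_rmod eps) (x - y) y.
    by rewrite subrK IHx IHy addr0.
  - rewrite -pureA -[RHS](pure0l (aug_rmod eps) m); congr pure.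
    by rewrite /GRing.scale /= ea mulr0.
pose phi (s : aug_rmod eps) (m : M) : M := (s : S)%:A *: m.
have -> : m = freeg_lift phi <<(1 : aug_rmod eps, m)>>.
  by rewrite freeg_liftU /phi !scale1r.
apply: (@freeg_lift_rel A (aug_rmod eps) M M phi (aug_part eps (M := M))).
- exact: AugPart0.
- exact: AugPartB.
- by move=> x y p; rewrite /phi !scalerDl subrr; exact: AugPart0.
- by move=> x p q; rewrite /phi scalerDr subrr; exact: AugPart0.
- move=> x a p; rewrite /phi scalerA -scalerBl; apply: AugPartZ.
  rewrite rmorphB rmorphM !epsA.1; exact: subrr.
- have := h; rewrite -(pi_tensor0 (aug_rmod eps) M) => /eq_tensor.
  by rewrite subr0.
Qed.

Lemma tensor_aug_pure1 (z : tensor (aug_rmod eps) M) : exists m, z = pure1 m.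
Proof.
elim/tensor_ind: z => [s m|_ _ [x ->] [y ->]].
  by exists ((s : S)%:A *: m); exact: pureE_aug.
exists (x - y); apply: (@addIr _ (pure1 y)).
by rewrite -pureDr !subrK.
Qed.

End GradedModule.

(** * The tensor ring *)

Lemma lrmorphism_exists (S : nzRingType) (B C : lalgType S) (f : B -> C) :
  linear f -> f 1 = 1 -> {morph f : x y / x * y} ->
  exists g : {lrmorphism B -> C}, g =1 f.
Proof.
move=> lin_f f1 fM.
pose ml := GRing.isLinear.Build _ _ _ _ f lin_f.
pose mm := GRing.isMonoidMorphism.Build _ _ f (conj f1 fM).
by exists (HB.pack_for {lrmorphism B -> C} f ml mm).
Qed.

Section TensorRingGeneration.
Variables (S : nzRingType) (A : lalgType S) (V : submodClosed A).
Variables (T : lalgType S) (j : {linear submod V -> T}).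

(** Generation by left multiplication with elements of V keeps inductions over T short; stability
    under all products is then proved. *)
Inductive tensor_gen : T -> Prop :=
| TensorGen1 : tensor_gen 1
| TensorGenD x y : tensor_gen x -> tensor_gen y -> tensor_gen (x + y)
| TensorGenZ s x : tensor_gen x -> tensor_gen (s *: x)
| TensorGenM v x : tensor_gen x -> tensor_gen (j v * x).

Definition tensor_genb : {pred T} := fun t => `[< tensor_gen t >].

Fact tensor_genb_closed : GRing.subsemialg_closed tensor_genb.
Proof.
split.
- by apply/asboolP; exact: TensorGen1.
- split=> [|x y /asboolP hx /asboolP hy]; apply/asboolP; last exact: TensorGenD.
  by rewrite -(scale0r 1); apply: TensorGenZ; exact: TensorGen1.
- by move=> s x /asboolP hx; apply/asboolP; exact: TensorGenZ.
- move=> x y /asboolP hx /asboolP hy; apply/asboolP.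
  elim: hx => [|u v _ IHu _ IHv|s u _ IHu|v u _ IHu].
  + by rewrite mul1r.
  + by rewrite mulrDl; exact: TensorGenD.
  + by rewrite -scalerAl; exact: TensorGenZ.
  + by rewrite -mulrA; exact: TensorGenM.
Qed.

Record tensor_gen_ring := TensorGenRing {
  tensor_gen_val : T; _ : tensor_gen_val \in tensor_genb }.
HB.instance Definition _ := [isSub for tensor_gen_val].
HB.instance Definition _ := [Choice of tensor_gen_ring by <:].
HB.instance Definition _ := GRing.SubChoice_isSubLalgebra.Build S T
  tensor_genb tensor_gen_ring tensor_genb_closed.

Hypothesis tensT : is_tensor_ring j.

(** By the universal property j extends to a map from T to the subring generated by V. Followed by
    the inclusion it fixes V, hence is the identity of T. *)
Lemma tensor_gen_all t : tensor_gen t.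
Proof.
have [jr univ uniq_ext] := tensT.
have jgen v : j v \in tensor_genb.
  by apply/asboolP; rewrite -(mulr1 (j v)); apply: TensorGenM; exact: TensorGen1.
pose j' v := TensorGenRing (jgen v).
have lin_j' : linear j' by move=> s x y; apply: val_inj; rewrite /= linearP.
pose ml := GRing.isLinear.Build _ _ _ _ j' lin_j'.
pose J : {linear submod V -> tensor_gen_ring} := HB.pack j' ml.
have [|g gE] := univ _ J.
  by move=> v w s vw; apply: val_inj; rewrite /= (jr _ _ _ vw).
have [|||vg vgE] := @lrmorphism_exists S T T (fun t => val (g t)).
- by move=> s x y; rewrite linearP.
- by rewrite rmorph1.
- by move=> x y; rewrite rmorphM.
have [|||i iE] := @lrmorphism_exists S T T id; [by []..|].
have := uniq_ext _ vg i _ t; rewrite vgE iE => <-.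
  by have /asboolP := valP (g t).
by move=> v; rewrite vgE iE gE.
Qed.

End TensorRingGeneration.

(** * The grading of the tensor ring, read in polynomials over it *)

Section PolyRestriction.
Variables (S : nzRingType) (T : lalgType S).

(** T['X] as an S-ring through the constants of T; since the indeterminate is central, v 'X is right
    S-linear in v. *)
Definition poly_restr : Type := {poly T}.
HB.instance Definition _ := GRing.NzRing.copy poly_restr {poly T}.

Let scale (s : S) (p : poly_restr) : poly_restr := s%:A *: (p : {poly T}).
Fact poly_scaleA a b s : scale a (scale b s) = scale (a * b) s.
Proof. by rewrite /scale scalerA -scalerAl mul1r scalerA. Qed.
Fact poly_scale1 : left_id 1 scale.
Proof. by move=> s; rewrite /scale !scale1r. Qed.
Fact poly_scaleDr : right_distributive scale +%R.
Proof. by move=> a s t; rewrite /scale scalerDr. Qed.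
Fact poly_scaleDl s : {morph scale^~ s : a b / a + b}.
Proof. by move=> a b; rewrite /scale scalerDl scalerDl. Qed.
HB.instance Definition _ := GRing.Zmodule_isLmodule.Build S poly_restr
  poly_scaleA poly_scale1 poly_scaleDr poly_scaleDl.
Fact poly_scaleAl (a : S) (u v : poly_restr) : a *: (u * v) = (a *: u) * v.
Proof. exact: (@scalerAl T {poly T} a%:A u v). Qed.
HB.instance Definition _ := GRing.Lmodule_isLalgebra.Build S poly_restr
  poly_scaleAl.

Lemma poly_restrZ (s : S) (p : poly_restr) : s *: p = s%:A *: (p : {poly T}).
Proof. by []. Qed.
End PolyRestriction.

Section TensorRingGrading.
Variables (S : nzRingType) (A : lalgType S) (V : submodClosed A).
Variables (T : lalgType S) (j : {linear submod V -> T}).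
Hypothesis tensT : is_tensor_ring j.

(* The grading of T_S(V) is read off the S-ring morphism T -> T['X] sending v
   to v 'X. *)
Lemma tensor_ring_grading : exists theta : {lrmorphism T -> poly_restr T},
  (forall v, theta (j v) = j v *: 'X) /\
  (forall t, exists N, forall M, (N <= M)%N ->
     t = \sum_(i < M) (theta t : {poly T})`_i).
Proof.
have [jr univ uniq_ext] := tensT.
pose f (v : submod V) : poly_restr T := j v *: ('X : {poly T}).
have lin_f : linear f.
  by move=> s x y; rewrite /f linearP scalerDl poly_restrZ scalerA -scalerAl mul1r.
pose ml := GRing.isLinear.Build _ _ _ _ f lin_f.
pose F : {linear submod V -> poly_restr T} := HB.pack f ml.
have [|theta thetaE] := univ _ F.
  move=> v w s vw.
  have -> : F v * s%:A = (j v *: 'X : {poly T}) * (s%:A *: 1) by [].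
  by rewrite alg_polyC -!mul_polyC -mulrA -commr_polyX mulrA -polyCM mul_polyC -(jr _ _ _ vw).
exists theta; split; first exact: thetaE.
have lead (t : T) M : (size (theta t : {poly T}) <= M)%N ->
    (theta t : {poly T}).[1] = \sum_(i < M) (theta t : {poly T})`_i.
  move=> tM; rewrite (horner_coef_wide _ tM).
  by apply: eq_bigr => i _; rewrite expr1n mulr1.
move=> t; exists (size (theta t : {poly T})) => M tM; rewrite -lead //.
(* Evaluating theta at 'X = 1 gives an S-ring endomorphism of T fixing V, hence the identity: t is
   the sum of the coefficients of theta t. *)
have [|||ev evE] := @lrmorphism_exists S T T (fun t => (theta t : {poly T}).[1]).
- by move=> s x y; rewrite linearP hornerD hornerZ -scalerAl mul1r.
- by rewrite rmorph1; exact: hornerC.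
- move=> x y; rewrite rmorphM.
  by rewrite hornerM_comm // /comm_poly mul1r mulr1.
have [|||i iE] := @lrmorphism_exists S T T id; [by []..|].
have := uniq_ext _ i ev _ t; rewrite evE iE; apply=> v.
by rewrite evE iE thetaE /= hornerZ hornerX mulr1.
Qed.

End TensorRingGrading.

(** * The Fox derivation, from a square-zero extension *)

Section FoxDerivation.
Variables (S : nzRingType) (A : lalgType S) (V : submodClosed A).
Hypothesis V_right : forall v s, v \in V -> v * s%:A \in V.

Definition submod_rmul (s : S) (v : submod V) : submod V :=
  Submod (V_right s (valP v)).

Local Notation M := (induced A (submod V)).

(** The right S-action on A (x)_S V through V; it is balanced because left and right multiplications
    in A commute. *)
Fact induced_rmul_exists (s : S) :
  exists f : {additive tensor (rreg A) (submod V) -> M},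
    forall x v, f (pure x v) = ipure (x : A) (submod_rmul s v).
Proof.
apply: tensor_lift_exists => [x y m|x m p|x t m].
- by rewrite ipureDl.
- by rewrite -ipureDr; congr ipure; apply: val_inj; rewrite /= mulrDl.
- rewrite rregZ ipureA; congr ipure; apply: val_inj.
  by rewrite /= scalerAl.
Qed.

Definition induced_rmul (z : M) (s : S) : M := sval (cid (induced_rmul_exists s)) z.

Lemma induced_rmulE x v s :
  induced_rmul (ipure x v) s = ipure x (submod_rmul s v).
Proof. by rewrite /induced_rmul; case: cid => f /= ->. Qed.
Lemma induced_rmulBl s : {morph induced_rmul^~ s : y z / y - z}.
Proof. by move=> y z; rewrite /induced_rmul raddfB. Qed.
Lemma induced_rmulDl s : {morph induced_rmul^~ s : y z / y + z}.
Proof. by move=> y z; rewrite /induced_rmul raddfD. Qed.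
Lemma induced_rmulDr z : {morph induced_rmul z : s t / s + t}.
Proof.
move=> s t; elim/induced_ind: z => [x v|y z IHy IHz].
  rewrite !induced_rmulE -ipureDr; congr ipure; apply: val_inj => /=.
  by rewrite scalerDl mulrDr.
by rewrite !induced_rmulBl IHy IHz opprD addrACA.
Qed.
Lemma induced_rmulZ a z s : induced_rmul (a *: z) s = a *: induced_rmul z s.
Proof.
elim/induced_ind: z => [x v|y z IHy IHz].
  by rewrite ipureZ !induced_rmulE ipureZ.
by rewrite scalerBr !induced_rmulBl IHy IHz scalerBr.
Qed.
Lemma induced_rmulA z s t : induced_rmul (induced_rmul z s) t = induced_rmul z (s * t).
Proof.
elim/induced_ind: z => [x v|y z IHy IHz].
  rewrite !induced_rmulE; congr ipure; apply: val_inj => /=.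
  by rewrite -mulrA -scalerAl mul1r scalerA.
by rewrite !induced_rmulBl IHy IHz.
Qed.
Lemma induced_rmul1 z : induced_rmul z 1 = z.
Proof.
elim/induced_ind: z => [x v|y z IHy IHz].
  rewrite induced_rmulE; congr ipure; apply: val_inj => /=.
  by rewrite scale1r mulr1.
by rewrite !induced_rmulBl IHy IHz.
Qed.
Lemma induced_rmul0 z : induced_rmul z 0 = 0.
Proof. by apply: (@addrI _ (induced_rmul z 0)); rewrite -induced_rmulDr !addr0. Qed.
Lemma induced_rmul0l s : induced_rmul 0 s = 0.
Proof. by have := induced_rmulBl s 0 0; rewrite !subrr. Qed.

Variable eps : {rmorphism A -> S}.
Hypothesis eps_alg : forall s, eps s%:A = s.

(* The square-zero extension of A by the bimodule A (x)_S V, on which A acts on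
   the right through eps. *)
Definition sqzero : Type := (A * M)%type.
HB.instance Definition _ := GRing.Zmodule.copy sqzero (A * M)%type.

Let one : sqzero := (1, 0).
Let mul (x y : sqzero) : sqzero :=
  (x.1 * y.1, x.1 *: y.2 + induced_rmul x.2 (eps y.1)).

Fact sqzero_mulA : associative mul.
Proof.
move=> [a m] [b n] [c p]; rewrite /mul /=; congr pair; first exact: mulrA.
rewrite scalerDr scalerA induced_rmulDl induced_rmulZ induced_rmulA rmorphM.
by rewrite addrA.
Qed.
Fact sqzero_mul1l : left_id one mul.
Proof. by move=> [a m]; rewrite /mul /= mul1r scale1r induced_rmul0l addr0. Qed.
Fact sqzero_mul1r : right_id one mul.
Proof. by move=> [a m]; rewrite /mul /= mulr1 scaler0 add0r rmorph1 induced_rmul1. Qed.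
Fact sqzero_mulDl : left_distributive mul +%R.
Proof.
move=> [a m] [b n] [c p]; rewrite /mul /=; congr pair; first exact: mulrDl.
by rewrite /= scalerDl induced_rmulDl addrACA.
Qed.
Fact sqzero_mulDr : right_distributive mul +%R.
Proof.
move=> [a m] [b n] [c p]; rewrite /mul /=; congr pair; first exact: mulrDr.
by rewrite /= scalerDr rmorphD induced_rmulDr addrACA.
Qed.
Fact sqzero_1neq0 : one != 0.
Proof. by apply/eqP => /(congr1 fst) /eqP; rewrite oner_eq0. Qed.
HB.instance Definition _ := GRing.Zmodule_isNzRing.Build sqzero
  sqzero_mulA sqzero_mul1l sqzero_mul1r sqzero_mulDl sqzero_mulDr sqzero_1neq0.

Let scale (s : S) (x : sqzero) : sqzero := (s *: x.1, s%:A *: x.2).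
Fact sqzero_scaleA a b s : scale a (scale b s) = scale (a * b) s.
Proof. by rewrite /scale /= !scalerA -scalerAl mul1r scalerA. Qed.
Fact sqzero_scale1 : left_id 1 scale.
Proof. by move=> [a m]; rewrite /scale /= !scale1r. Qed.
Fact sqzero_scaleDr : right_distributive scale +%R.
Proof. by move=> a s t; rewrite /scale /= !scalerDr. Qed.
Fact sqzero_scaleDl s : {morph scale^~ s : a b / a + b}.
Proof. by move=> a b; rewrite /scale /= !scalerDl. Qed.
HB.instance Definition _ := GRing.Zmodule_isLmodule.Build S sqzero
  sqzero_scaleA sqzero_scale1 sqzero_scaleDr sqzero_scaleDl.
Fact sqzero_scaleAl (a : S) (u v : sqzero) : a *: (u * v) = (a *: u) * v.
Proof.
case: u v => [b m] [c n]; congr pair; first exact: scalerAl.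
rewrite /= scalerDr scalerA induced_rmulZ.
by rewrite -[b in RHS]mul1r scalerAl.
Qed.
HB.instance Definition _ := GRing.Lmodule_isLalgebra.Build S sqzero sqzero_scaleAl.

Lemma sqzeroM (x y : sqzero) :
  x * y = (x.1 * y.1, x.1 *: y.2 + induced_rmul x.2 (eps y.1)).
Proof. by []. Qed.

Variables (T : lalgType S) (j : {linear submod V -> T}).
Hypothesis tensT : is_tensor_ring j.
Variable pi : {lrmorphism T -> A}.
Hypothesis canpi : is_canonical_map j pi.

(** The map v |-> (v, 1 (x) v) extends to an S-ring map from T to the square-zero extension. Its
    first component agrees with pi on V, hence is pi; its second is del. The product rule is
    recorded for eps (pi u) = 0, where the term del t eps (pi u) vanishes. *)
Lemma fox_derivation : exists del : {linear T -> restr M},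
  [/\ del 1 = 0, forall v, del (j v) = ipure 1 v &
      forall t u, eps (pi u) = 0 -> del (t * u) = pi t *: (del u : M)].
Proof.
have [jr univ uniq_ext] := tensT.
pose f (v : submod V) : sqzero := (val v, ipure 1 v).
have lin_f : linear f.
  move=> s x y; rewrite /f ipureDr -ipureA mul1r ipureE.
  exact: (congr2 pair (linearP (val : submod V -> A) s x y) (erefl _)).
pose ml := GRing.isLinear.Build _ _ _ _ f lin_f.
pose F : {linear submod V -> sqzero} := HB.pack f ml.
have [|phi phiE] := univ _ F.
  (* Right multiplication by s acts on the second component through [eps s%:A = s], so that 1 (x) v
     becomes 1 (x) v s. *)
  move=> v w s vw; rewrite sqzeroM /= eps_alg induced_rmulE.
  rewrite !scaler0 add0r /f vw; congr (_, ipure _ _).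
  by apply: val_inj.
have phi1 t : (phi t).1 = pi t.
  have [|||g gE] := @lrmorphism_exists S T A (fun t => (phi t).1).
  - by move=> s x y; rewrite linearP.
  - by rewrite rmorph1.
  - by move=> x y; rewrite rmorphM.
  have := uniq_ext _ g pi _ t; rewrite gE; apply=> v.
  by rewrite gE phiE canpi.
pose del t : restr M := (phi t).2.
have lin_del : linear del by move=> s x y; rewrite /del linearP.
pose md := GRing.isLinear.Build _ _ _ _ del lin_del.
exists (HB.pack_for {linear T -> restr M} del md); split=> /=.
- by rewrite /del rmorph1.
- by move=> v; rewrite /del phiE.
- by move=> t u eu; rewrite /del rmorphM sqzeroM /= !phi1 eu induced_rmul0 addr0.
Qed.

End FoxDerivation.

Section MulSpan.
Variables (A : pzRingType) (X Y : set A).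

Lemma mulspan0 : mulspan X Y 0.
Proof. by exists [::]; rewrite big_nil; split. Qed.

Lemma mulspanM x y : X x -> Y y -> mulspan X Y (x * y).
Proof.
move=> Xx Yy; exists [:: (x, y)]; rewrite big_seq1; split=> // u.
by rewrite inE => /eqP ->.
Qed.

Lemma mulspanD x y : mulspan X Y x -> mulspan X Y y -> mulspan X Y (x + y).
Proof.
move=> [s [hs ->]] [t [ht ->]]; exists (s ++ t); rewrite big_cat; split=> // u.
by rewrite mem_cat => /orP[/hs|/ht].
Qed.

Lemma mulspan_ind (Pr : A -> Prop) a :
  Pr 0 -> (forall x y, Pr x -> Pr y -> Pr (x + y)) ->
  (forall x y, X x -> Y y -> Pr (x * y)) -> mulspan X Y a -> Pr a.
Proof.
move=> P0 PD PM [s [hs ->]]; rewrite big_seq; apply: big_ind => // u /hs[].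
exact: PM.
Qed.
End MulSpan.

(** * Homogeneous elements of the tensor ring *)

Section TensorRingDegrees.
Variables (S : nzRingType) (A : lalgType S) (V : submodClosed A).
Variables (T : lalgType S) (j : {linear submod V -> T}).
Local Notation tdeg := (tensor_ring_deg j).

Lemma tdegD n x y : tdeg n x -> tdeg n y -> tdeg n (x + y).
Proof.
case: n => [|n] /=; last exact: mulspanD.
by move=> [s _ <-] [t _ <-]; exists (s + t); rewrite //= scalerDl.
Qed.

Lemma tdeg0 n : tdeg n 0.
Proof.
case: n => [|n] /=; last exact: mulspan0.
by exists 0; rewrite //= scale0r.
Qed.

Lemma tdegZ n s x : tdeg n x -> tdeg n (s *: x).
Proof.
case: n => [|n] /=; first by move=> [t _ <-]; exists (s * t); rewrite //= scalerA.
apply: (mulspan_ind (Pr := fun x => mulspan _ _ (s *: x))) => [|y z hy hz|_ y [v _ <-] hy].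
- by rewrite scaler0; exact: mulspan0.
- by rewrite scalerDr; exact: mulspanD.
- by rewrite scalerAl -linearZ; apply: mulspanM => //; exists (s *: v).
Qed.

Lemma tdegB n x y : tdeg n x -> tdeg n y -> tdeg n (x - y).
Proof. by move=> hx hy; apply: tdegD => //; rewrite -scaleN1r; exact: tdegZ. Qed.

Lemma tdegM n m x y : tdeg n x -> tdeg m y -> tdeg (n + m) (x * y).
Proof.
elim: n x => [|n IHn] x /=.
  by move=> [s _ <-] hy; rewrite /= -scalerAl mul1r; exact: tdegZ.
move=> hx hy; move: hx; apply: (mulspan_ind (Pr := fun x => mulspan _ _ (x * y)))
  => [|u v hu hv|u v hu hv].
- by rewrite mul0r; exact: mulspan0.
- by rewrite mulrDl; exact: mulspanD.
- by rewrite -mulrA; apply: mulspanM => //; exact: IHn.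
Qed.

(** Degrees are defined by splitting off a factor of V on the left, whereas del is computed by
    splitting one off on the right. *)
Lemma tdegS_right n x : right_linear j -> (forall v s, v \in V -> v * s%:A \in V) ->
  tdeg n.+1 x -> mulspan (tdeg n) (range j) x.
Proof.
move=> jr Vr; elim: n x => [|n IHn] x /=.
  apply: (mulspan_ind (Pr := fun x => mulspan _ _ x))
    => [|u v hu hv|_ _ [v _ <-] [s _ <-]]; [exact: mulspan0|exact: mulspanD|].
  (* In degree 1 the scalar on the right is absorbed into the element of V. *)
  have -> : j v * in_alg T s = 1 * j (Submod (Vr _ s (valP v))).
    by rewrite mul1r; symmetry; exact: jr.
  by apply: mulspanM; [exists 1; rewrite //= scale1r|eexists].
apply: (mulspan_ind (Pr := fun x => mulspan _ _ x))
  => [|u w hu hw|u t hu /IHn]; [exact: mulspan0|exact: mulspanD|].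
apply: (mulspan_ind (Pr := fun t => mulspan _ _ (u * t))) => [|t1 t2 h1 h2|t' w ht' hw].
- by rewrite mulr0; exact: mulspan0.
- by rewrite mulrDr; exact: mulspanD.
- by rewrite mulrA; apply: mulspanM => //; exact: mulspanM.
Qed.

Variable theta : {lrmorphism T -> poly_restr T}.
Hypothesis thetaE : forall v, theta (j v) = j v *: 'X.

Lemma theta_coefM_left v t n :
  (theta (j v * t) : {poly T})`_n = if n is n'.+1 then j v * (theta t : {poly T})`_n' else 0.
Proof.
have -> : theta (j v * t) = theta (j v) * theta t by exact: rmorphM.
rewrite thetaE.
have -> : ((j v *: 'X : poly_restr T) * theta t)%R = j v *: ('X * (theta t : {poly T})).
  exact: (esym (@scalerAl T {poly T} (j v) 'X (theta t : {poly T}))).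
by rewrite coefZ coefXM; case: n => [|n] //=; rewrite mulr0.
Qed.

Lemma theta_coefM_right v t n :
  (theta (t * j v) : {poly T})`_n = if n is n'.+1 then (theta t : {poly T})`_n' * j v else 0.
Proof.
have -> : theta (t * j v) = theta t * theta (j v) by exact: rmorphM.
rewrite thetaE.
have -> : (theta t * (j v *: 'X : poly_restr T))%R
    = (theta t : {poly T}) * (j v)%:P * 'X.
  by rewrite -mulrA mul_polyC.
by rewrite coefMX; case: n => [|n] //=; rewrite coefMC.
Qed.

Lemma theta_homogeneous n t m : tdeg n t ->
  (theta t : {poly T})`_m = if m == n then t else 0.
Proof.
elim: n t m => [|n IHn] t m /=.
  move=> [s _ <-] /=.
  have -> : theta s%:A = (s%:A)%:P :> {poly T}.
    by rewrite linearZ_LR rmorph1; exact: alg_polyC.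
  by rewrite coefC.
apply: (mulspan_ind (Pr := fun x => (theta x : {poly T})`_m = if m == n.+1 then x else 0))
  => [|x y hx hy|_ y [v _ <-] hy].
- by rewrite linear0 coef0; case: eqP.
- have -> : theta (x + y) = (theta x : {poly T}) + (theta y : {poly T}) by exact: linearD.
  by rewrite coefD hx hy; case: eqP => //; rewrite addr0.
- rewrite theta_coefM_left; case: m => [|m] //.
  by rewrite IHn // eqSS; case: eqP => //; rewrite mulr0.
Qed.

Lemma theta_coefD x y n :
  (theta (x + y) : {poly T})`_n = (theta x : {poly T})`_n + (theta y : {poly T})`_n.
Proof.
have -> : theta (x + y) = (theta x : {poly T}) + (theta y : {poly T}) by exact: linearD.
exact: coefD.
Qed.

Lemma theta_coefZ s x n : (theta (s *: x) : {poly T})`_n = s *: (theta x : {poly T})`_n.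
Proof.
have -> : theta (s *: x) = s%:A *: (theta x : {poly T}) by rewrite linearZ_LR.
by rewrite coefZ -scalerAl mul1r.
Qed.

Lemma theta_coef0 n : (theta 0 : {poly T})`_n = 0.
Proof. by rewrite linear0 coef0. Qed.

(** With [theta_homogeneous], this makes the n-th coefficient of theta the projection of T onto
    T^n. *)
Lemma theta_coef_deg t n : is_tensor_ring j -> tdeg n (theta t : {poly T})`_n.
Proof.
move=> tensT; elim: (tensor_gen_all tensT t) n
    => [|x y _ IHx _ IHy|s x _ IHx|v x _ IHx] n.
- rewrite (@theta_homogeneous 0) //; last by exists 1; rewrite //= scale1r.
  by case: eqP => [->|_]; [exists 1; rewrite //= scale1r|exact: tdeg0].
- by rewrite theta_coefD; exact: tdegD.
- by rewrite theta_coefZ; exact: tdegZ.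
- rewrite theta_coefM_left; case: n => [|n]; first exact: tdeg0.
  by apply: mulspanM; [exists v|exact: IHx].
Qed.

End TensorRingDegrees.

(** * The resolution A (x) R -> A (x) A^1 -> A -> S *)

Section ResolutionStart.
Variables (S : nzRingType) (A : lalgType S) (gr : nat -> submodClosed A).
Hypotheses (grA : is_graded_ring gr) (connA : is_connected gr)
  (strA : is_strongly_graded gr).
Variables (T : lalgType S) (j : {linear submod (gr 1%N) -> T}).
Hypothesis tensT : is_tensor_ring j.
Variable pi : {lrmorphism T -> A}.
Hypothesis canpi : is_canonical_map j pi.
Variable R : submodClosed T.
Hypothesis relR : is_bimodule_of_relations j pi R.
Variable eps : {rmorphism A -> S}.
Hypothesis epsA : is_augmentation gr eps.

Local Notation L1 := (submod (gr 1%N)).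
Local Notation L2 := (submod R).
Local Notation tdeg := (tensor_ring_deg j).
Local Notation M1 := (induced A L1).
Local Notation M2 := (induced A L2).

Lemma piM t u : pi (t * u) = pi t * pi u. Proof. exact: rmorphM. Qed.
Lemma piZ s t : pi (s *: t) = s *: pi t. Proof. exact: linearZ. Qed.
Lemma piB t u : pi (t - u) = pi t - pi u. Proof. exact: linearB. Qed.
Lemma pi_alg s : pi s%:A = s%:A. Proof. by rewrite piZ rmorph1. Qed.

Lemma gr_alg s : s%:A \in gr 0.
Proof. by apply: rpredZ; case: grA. Qed.

Lemma gr1_right v s : v \in gr 1 -> v * s%:A \in gr 1.
Proof. by case: grA => _ _ M v1; have := M _ _ _ _ v1 (gr_alg s). Qed.

Lemma gr0_alg a : a \in gr 0 -> exists s, a = s%:A.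
Proof.
case: connA => _ E a0.
have : [set` gr 0]%classic a by [].
by rewrite -E => -[s _ <-]; exists s.
Qed.

Lemma gr_mulspan n m a : a \in gr (n + m)%N -> mulspan [set` gr n] [set` gr m] a.
Proof. by move=> h; rewrite strA. Qed.

Lemma pi_deg n t : tdeg n t -> pi t \in gr n.
Proof.
elim: n t => [|n IHn] t /=.
  by move=> [s _ <-]; rewrite /= pi_alg; exact: gr_alg.
apply: (mulspan_ind (Pr := fun t => pi t \in gr n.+1)) => [|x y hx hy|_ y [v _ <-] hy].
- by rewrite linear0 rpred0.
- by rewrite linearD rpredD.
- rewrite piM canpi; case: grA => _ _ M.
  exact: (M 1%N n _ _ (valP v) (IHn _ hy)).
Qed.

(** Strong grading gives A^(n+1) = A^1 A^n, so A is generated over S by A^1, and lifts are built one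
    factor at a time. *)
Lemma pi_deg_surj n a : a \in gr n -> exists2 t, tdeg n t & pi t = a.
Proof.
elim: n a => [|n IHn] a ha.
  have [s ->] := gr0_alg ha; exists (s%:A); first by exists s.
  by rewrite pi_alg.
have : mulspan [set` gr 1%N] [set` gr n] a by exact: gr_mulspan.
apply: (mulspan_ind (Pr := fun a => exists2 t, tdeg n.+1 t & pi t = a)).
- by exists 0; [exact: tdeg0|exact: linear0].
- move=> _ _ [t ht <-] [u hu <-]; exists (t + u); last exact: linearD.
  exact: tdegD.
- move=> v b hv /IHn[t ht <-]; pose w : L1 := Submod (hv : v \in gr 1).
  exists (j w * t); last by rewrite piM canpi.
  by apply: mulspanM => //; exists w.
Qed.

Lemma pi_surj a : exists t, pi t = a.
Proof.
have [N [c [cgr ->]]] := (gr_ring_sum grA).1 a.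
elim/big_ind: _ => [|_ _ [t <-] [u <-]|i _]; first by exists 0; exact: linear0.
  by exists (t + u); exact: linearD.
by have [t _ <-] := pi_deg_surj (cgr i); exists t.
Qed.

Lemma rel_pi r : r \in R -> pi r = 0.
Proof.
case: relR => _ _ E _ hr; have : relation_ideal pi r; last by [].
rewrite E; exists r => //; exists 0; last by rewrite addr0.
by exists 0; [exact: mulspan0|exists 0; [exact: mulspan0|rewrite addr0]].
Qed.

Lemma eps_gr1 v : v \in gr 1 -> eps v = 0.
Proof. by move=> hv; apply: (epsA.2 1%N). Qed.

Lemma fox_exists : exists del : {linear T -> restr M1},
  [/\ del 1 = 0, forall v, del (j v) = ipure 1 v &
      forall t u, eps (pi u) = 0 -> del (t * u) = pi t *: (del u : M1)].
Proof. exact: (fox_derivation gr1_right epsA.1 tensT canpi). Qed.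

Lemma val_linear1 : linear (val : L1 -> restr A^o).
Proof.
move=> s x y; rewrite restrZ -[(s *: 1) *: _]/(s%:A * val x) -scalerAl mul1r.
exact: (linearP (val : L1 -> A)).
Qed.

Lemma boundary1_exists : exists d1 : {linear M1 -> A^o},
  forall a v, d1 (ipure a v) = a * val v.
Proof.
pose mv := GRing.isLinear.Build _ _ _ _ (val : L1 -> restr A^o) val_linear1.
exact: (induced_extension (HB.pack_for {linear L1 -> restr A^o} (val : L1 -> restr A^o) mv)).
Qed.

Variable del : {linear T -> restr M1}.
Hypothesis del1 : del 1 = 0.
Hypothesis delj : forall v, del (j v) = ipure 1 v.
Hypothesis delM : forall t u, eps (pi u) = 0 -> del (t * u) = pi t *: (del u : M1).
Variable d1 : {linear M1 -> A^o}.
Hypothesis d1E : forall a v, d1 (ipure a v) = a * val v.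

Lemma boundary2_exists : exists d2 : {linear M2 -> M1},
  forall a r, d2 (ipure a r) = a *: (del (val r) : M1).
Proof.
pose f (r : L2) : restr M1 := del (val r).
have lin_f : linear f by move=> s x y; rewrite /f !linearP.
pose mf := GRing.isLinear.Build _ _ _ _ f lin_f.
exact: (induced_extension (HB.pack_for {linear L2 -> restr M1} f mf)).
Qed.

Variable d2 : {linear M2 -> M1}.
Hypothesis d2E : forall a r, d2 (ipure a r) = a *: (del (val r) : M1).

Lemma eps_boundary1 y : eps (d1 y) = 0.
Proof.
elim/induced_ind: y => [x v|y z IHy IHz].
  by rewrite d1E rmorphM (eps_gr1 (valP v)) mulr0.
by rewrite linearB rmorphB IHy IHz subrr.
Qed.

(** The degree 0 component of a is a scalar killed by eps, hence 0. In positive degree, A^(i+1) =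
    A^i A^1 lies in the image of d1. *)
Lemma exact0 (a : A) : eps a = 0 -> exists y, d1 y = a.
Proof.
move=> ea; have [N hN] := component_bound (gr_ring_closed gr) (gr_ring_sum grA) a.
rewrite (hN N) //; elim/big_ind: _ => [|_ _ [t <-] [u <-]|[i iN] _].
- by exists 0; exact: linear0.
- by exists (t + u); exact: linearD.
have := component_in (gr_ring_closed gr) (gr_ring_sum grA) i a.
case: i iN => [|i] _ /=.
  move=> h0; have := aug_component grA epsA 0 ea.
  have [s ->] := gr0_alg h0; rewrite epsA.1 => ->.
  by exists 0; rewrite linear0 scale0r.
rewrite -addn1 => /gr_mulspan.
apply: (mulspan_ind (Pr := fun a => exists y, d1 y = a)).
- by exists 0; exact: linear0.
- by move=> _ _ [t <-] [u <-]; exists (t + u); exact: linearD.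
- by move=> x v hx hv; exists (ipure (x : A) (Submod (hv : (v : A) \in gr 1)) : M1); rewrite d1E.
Qed.

(** The fundamental formula of Fox calculus; it makes d1 (del r) vanish for r in R. *)
Lemma boundary1_del t : d1 (del t) = pi t - (eps (pi t))%:A.
Proof.
elim: (tensor_gen_all tensT t) => [|x y _ IHx _ IHy|s x _ IHx|v x _ IHx].
- by rewrite del1 !rmorph1 linear0 scale1r subrr.
- have -> : del (x + y) = del x + del y :> M1 by exact: linearD.
  by rewrite linearD IHx IHy !rmorphD scalerDl opprD addrACA.
- have -> : del (s *: x) = s%:A *: (del x : M1) :> M1 by rewrite linearZ_LR.
  rewrite linearZ_LR IHx piZ.
  have -> : eps (s *: pi x) = s * eps (pi x).
    by rewrite -[pi x in LHS]mul1r scalerAl rmorphM epsA.1.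
  by rewrite -scalerA -scalerBr /= -[in RHS](mul1r (_ - _)) scalerAl.
set s := eps (pi x) in IHx *.
have ex : eps (pi (x - s%:A)) = 0.
  by rewrite piB rmorphB pi_alg epsA.1 subrr.
have jvs : j v * s%:A = j (Submod (gr1_right s (valP v))).
  by case: tensT => jr _ _; symmetry; exact: jr.
(* Removing from x its constant term s puts the first product within reach of [delM]; the second is
   again an element of V. *)
have -> : j v * x = j v * (x - s%:A) + j v * s%:A by rewrite -mulrDr subrK.
have delx : del (x - s%:A) = del x.
  by rewrite linearB [del s%:A]linearZ_LR del1 scaler0 subr0.
have -> : del (j v * (x - s%:A) + j v * s%:A)
    = pi (j v) *: (del x : M1) + ipure 1 (Submod (gr1_right s (valP v))) :> M1.
  by rewrite linearD delM // delx jvs delj.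
rewrite -mulrDr subrK piM canpi rmorphM (eps_gr1 (valP v)) mul0r scale0r subr0.
rewrite linearD linearZ_LR IHx d1E mul1r /=.
by rewrite -[_ *: _ in LHS]/(val v * _) -mulrDr subrK.
Qed.

Lemma boundary12 z : d1 (d2 z) = 0.
Proof.
elim/induced_ind: z => [x r|y z IHy IHz].
  rewrite d2E linearZ_LR boundary1_del rel_pi ?rmorph0 ?scale0r ?subr0 ?scaler0 //.
  exact: (valP r).
by rewrite !linearB IHy IHz subrr.
Qed.

(** On x (x) v the witness is t v with pi t = x. Thus a cycle y is del t for some t in I, and
    exactness becomes a statement about del on I. *)
Lemma del_lift y : exists2 t, del t = y & pi t = d1 y.
Proof.
elim/induced_ind: y => [x v|y z [t <- pt] [u <- pu]].
  have [t <-] := pi_surj x; exists (t * j v); last by rewrite d1E piM canpi.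
  rewrite delM ?delj -?ipureE //.
  by rewrite canpi; apply/eps_gr1/(valP v).
by exists (t - u); [exact: linearB|rewrite piB pt pu linearB].
Qed.

(** * Exactness at A (x) A^1 by a graded Nakayama argument *)

Section Nakayama.
Variable theta : {lrmorphism T -> poly_restr T}.
Hypothesis thetaE : forall v, theta (j v) = j v *: 'X.
Hypothesis theta_sum : forall t, exists N, forall M, (N <= M)%N ->
  t = \sum_(i < M) (theta t : {poly T})`_i.

(** The ideal I is graded: the elements pi (t_i) are homogeneous of distinct degrees in A and add up
    to 0. *)
Lemma pi_theta_coef t n : pi t = 0 -> pi (theta t : {poly T})`_n = 0.
Proof.
move=> pt; have [N hN] := theta_sum t.
apply: ((gr_ring_sum grA).2 (maxn N n.+1) (fun i => pi (theta t : {poly T})`_i)).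
- by move=> i; apply: pi_deg; exact: theta_coef_deg.
- by rewrite -raddf_sum -(hN _ (leq_maxl _ _)).
- exact: leq_maxr.
Qed.

Let image_d2 (y : M1) := exists z, d2 z = y.
Let image0 : image_d2 0. Proof. by exists 0; exact: linear0. Qed.
Let imageD x y : image_d2 x -> image_d2 y -> image_d2 (x + y).
Proof. by move=> [t <-] [u <-]; exists (t + u); exact: linearD. Qed.
Let imageZ a x : image_d2 x -> image_d2 (a *: x).
Proof. by move=> [t <-]; exists (a *: t); exact: linearZ. Qed.
Let delD x y : del (x + y) = del x + del y :> M1. Proof. exact: linearD. Qed.
Let del0 : del 0 = 0 :> M1. Proof. exact: linear0. Qed.

Let del_rel_coef r n : r \in R -> image_d2 (del (theta r : {poly T})`_n).
Proof.
case: relR => _ Rdeg _ _ hr; have [N [c [hc ->]]] := Rdeg r hr.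
elim/big_ind: _ => [|u w hu hw|i _].
- by rewrite theta_coef0 del0.
- by rewrite theta_coefD delD; exact: imageD.
have [hi di] := hc i; rewrite (theta_homogeneous thetaE _ di).
case: eqP => _; last by rewrite del0.
by exists (ipure 1 (Submod hi)); rewrite d2E scale1r.
Qed.

(** Induction on the degree along I = R + A^1 I + I A^1. On R the map del is d2 of 1 (x) r; del (v
    x) = v del x lowers the degree; and del (x v) = pi x (x) v is 0 for x in I. *)
Lemma del_relation_coef n t : pi t = 0 -> image_d2 (del (theta t : {poly T})`_n).
Proof.
case: relR => _ _ RE _; elim: n t => [|n IHn] t pt.
all: have : relation_ideal pi t by [].
all: rewrite RE => -[r hr [_ [x hx [y hy <-]] <-]].
all: rewrite !theta_coefD !delD; apply: imageD; first exact: del_rel_coef.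
all: apply: imageD.
(* A product with a factor in V has no component in degree 0. *)
- move: hx; apply: (mulspan_ind (Pr := fun x => image_d2 (del (theta x : {poly T})`_0))).
  + by rewrite theta_coef0 del0.
  + by move=> u w hu hw; rewrite theta_coefD delD; exact: imageD.
  + by move=> _ w [v _ <-] _; rewrite theta_coefM_left // del0.
- move: hy; apply: (mulspan_ind (Pr := fun x => image_d2 (del (theta x : {poly T})`_0))).
  + by rewrite theta_coef0 del0.
  + by move=> u w hu hw; rewrite theta_coefD delD; exact: imageD.
  + by move=> w _ _ [v _ <-]; rewrite theta_coefM_right // del0.
- move: hx; apply: (mulspan_ind (Pr := fun x => image_d2 (del (theta x : {poly T})`_n.+1))).
  + by rewrite theta_coef0 del0.
  + by move=> u w hu hw; rewrite theta_coefD delD; exact: imageD.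
  + move=> _ w [v _ <-] pw; rewrite theta_coefM_left // delM.
      by apply: imageZ; apply: IHn.
    by rewrite pi_theta_coef // rmorph0.
- move: hy; apply: (mulspan_ind (Pr := fun x => image_d2 (del (theta x : {poly T})`_n.+1))).
  + by rewrite theta_coef0 del0.
  + by move=> u w hu hw; rewrite theta_coefD delD; exact: imageD.
  + move=> w _ pw [v _ <-]; rewrite theta_coefM_right // delM.
      by rewrite pi_theta_coef // scale0r.
    by rewrite canpi; apply/eps_gr1/(valP v).
Qed.

Lemma exact1 y : d1 y = 0 -> image_d2 y.
Proof.
have [t <- pt] := del_lift y; move=> dy.
have [N hN] := theta_sum t; rewrite (hN N) //.
have -> : del (\sum_(i < N) (theta t : {poly T})`_i)
    = \sum_(i < N) (del (theta t : {poly T})`_i : M1) :> M1 by exact: linear_sum.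
elim/big_ind: _ => // i _; apply: del_relation_coef.
by rewrite pt.
Qed.
End Nakayama.

(** * Vanishing above the top degree of A *)

Section Bounded.
Variable d : nat.
Hypothesis gr_top : forall n a, (d < n)%N -> a \in gr n -> a = 0.

(** Write r as a sum of products v t with t of degree m - 1 > d. Then t is in I, so r is
    decomposable, and R meets A^1 I + I A^1 only in 0. *)
Lemma relation_degree_bound m r : r \in R -> tdeg m r -> (d.+2 <= m)%N -> r = 0.
Proof.
case: relR => _ _ _ R0; case: m => [|m] // hr hdeg dm.
have : ([set` R] `&` decomposable_relations j pi)%classic r; last by rewrite R0.
split=> //; exists r; last by exists 0; [exact: mulspan0|rewrite addr0].
move: hdeg; rewrite /=.
apply: (mulspan_ind (Pr := fun x => mulspan _ _ x)).
- exact: mulspan0.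
- exact: mulspanD.
move=> u t hu /pi_deg ht; apply: mulspanM => //.
by apply: (gr_top _ ht).
Qed.

(** Splitting a factor off on the right, del (u v) = pi u (x) v, where u has degree m - 1 > d and so
    pi u = 0. *)
Lemma del_high m t : tdeg m t -> (d.+2 <= m)%N -> del t = 0.
Proof.
case: m => [|m] // ht dm; have [jr _ _] := tensT.
have := tdegS_right jr gr1_right ht.
apply: (mulspan_ind (Pr := fun t => del t = 0)).
- exact: linear0.
- by move=> x y hx hy; rewrite linearD hx hy addr0.
move=> u _ /pi_deg hu [v _ <-]; rewrite delM; last by rewrite canpi; apply/eps_gr1/(valP v).
by rewrite (gr_top _ hu) // scale0r.
Qed.

(** If t in T^i lifts a, then a del r = del (t r) because r lies in I, and t r has degree i + k. *)
Lemma boundary2_high i k a (r : L2) : a \in gr i -> tdeg k (val r) ->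
  (d.+2 <= i + k)%N -> d2 (ipure a r) = 0.
Proof.
move=> /pi_deg_surj[t ht <-] hr dik; rewrite d2E -delM; last by rewrite rel_pi ?rmorph0 // (valP r).
by apply: del_high dik; exact: tdegM.
Qed.
End Bounded.

Definition relation_gr (n : nat) : {pred L2} := fun r => `[< tdeg n (val r) >].

Lemma relation_gr_closed n : zmod_closed (relation_gr n).
Proof.
split=> [|x y /asboolP hx /asboolP hy]; apply/asboolP; first exact: tdeg0.
exact: tdegB.
Qed.

Lemma relation_gr_scale n s (r : L2) : r \in relation_gr n -> s *: r \in relation_gr n.
Proof. by move=> /asboolP hr; apply/asboolP; exact: tdegZ. Qed.

(** Existence of decompositions is the gradedness of R; uniqueness is seen on the coefficients of
    theta. *)
Lemma relation_gr_sum : is_direct_sum relation_gr.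
Proof.
have [theta [thetaE _]] := tensor_ring_grading tensT.
case: relR => _ Rdeg _ _; split=> [r|n c hc sum0 i lt_in].
  have [n [c [hc rE]]] := Rdeg _ (valP r).
  exists n, (fun i => Submod (hc i).1 : L2); split=> [i|].
    by apply/asboolP; exact: (hc i).2.
  by apply: val_inj; rewrite rE raddf_sum.
have /(congr1 (fun r : L2 => (theta (val r) : {poly T})`_i)) := sum0.
rewrite raddf_sum (big_morph (fun t => (theta t : {poly T})`_i)
  (fun x y => theta_coefD theta x y i) (theta_coef0 theta i)).
rewrite (bigD1 (Ordinal lt_in)) //= big1 => [|k ki].
  have /asboolP hi := hc i.
  rewrite (theta_homogeneous thetaE _ hi) eqxx addr0 theta_coef0 => ci0.
  exact: val_inj.
have /asboolP hk := hc k; rewrite (theta_homogeneous thetaE _ hk).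
case: eqP => // ik; case/eqP: ki; exact: val_inj.
Qed.

End ResolutionStart.

(** * Comparison with an arbitrary graded resolution *)

Section HomogeneousLift.
Variables (S : nzRingType) (A : lalgType S) (gr : nat -> submodClosed A).
Hypothesis grA : is_graded_ring gr.
Variables (L : lmodType S) (grL : nat -> {pred L}).
Hypotheses (closedL : forall n, zmod_closed (grL n)) (sumL : is_direct_sum grL).
Hypothesis scaleL : forall n s l, l \in grL n -> s *: l \in grL n.
Variable D : nat.
Hypothesis boundL : forall n l, (D <= n)%N -> l \in grL n -> l = 0.
Hypothesis projL : projective L.
Variables (X Y : lmodType A) (grX : nat -> zmodClosed X) (grY : nat -> zmodClosed Y).
Hypotheses (sumX : is_direct_sum grX) (sumY : is_direct_sum grY).
Hypothesis actX : forall n m (a : A) p,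
  a \in gr n -> p \in grX m -> a *: p \in grX (n + m)%N.
Variable delta : {linear X -> Y}.
Hypothesis delta_gr : forall n x, x \in grX n -> delta x \in grY n.
Variable u : {linear L -> restr Y}.
Hypothesis u_gr : forall n l, l \in grL n -> (u l : Y) \in grY n.
Hypothesis u_lift : forall l, exists x, delta x = u l.

Let closedX n : zmod_closed (grX n). Proof. exact: zmodClosedP. Qed.
Let closedY n : zmod_closed (grY n). Proof. exact: zmodClosedP. Qed.

(** Projectivity gives a lift phi0 that may mix degrees. Its degree-preserving part is still a lift,
    because delta and u preserve degrees. *)
Lemma homogeneous_lift : exists phi : {linear L -> restr X},
  (forall l, delta (phi l) = u l) /\
  (forall n l, l \in grL n -> (phi l : X) \in grX n).
Proof.
have lin_delta : linear (delta : restr X -> restr Y).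
  by move=> s x y; rewrite restrZ linearP.
pose md := GRing.isLinear.Build _ _ _ _ (delta : restr X -> restr Y) lin_delta.
pose delta' := HB.pack_for {linear restr X -> restr Y} (delta : restr X -> restr Y) md.
have [phi0 phi0E] := projective_lift (g := delta') projL u_lift.
(* The bound D on the degrees of L gives one finite range of summation for all l, which makes
   linearity visible. *)
pose phi (l : L) : restr X :=
  \sum_(n < D) component grX n (phi0 (component grL n l) : X).
have lin_phi : linear phi.
  move=> s l m; rewrite /phi scaler_sumr -big_split; apply: eq_bigr => n _ /=.
  have -> : component grL n (s *: l + m) = s *: component grL n l + component grL n m.
    rewrite componentD //; congr (_ + _).
    apply: (@component_morph L L grL grL (fun x => s *: x) n l closedL sumL closedL sumL).
      by move=> x y; rewrite scalerBr.
    by move=> k x; exact: scaleL.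
  have -> : phi0 (s *: component grL n l + component grL n m)
      = s%:A *: (phi0 (component grL n l) : X) + (phi0 (component grL n m) : X) :> X.
    exact: linearP.
  rewrite componentD // (@component_scale _ _ gr _ grX sumX actX 0) ?subn0 //.
  by apply: rpredZ; case: grA.
pose mp := GRing.isLinear.Build _ _ _ _ phi lin_phi.
exists (HB.pack_for {linear L -> restr X} phi mp); split=> [l|n l hl] /=.
  have -> : delta (phi l) = \sum_(n < D) delta (component grX n (phi0 (component grL n l) : X)).
    exact: linear_sum.
  have lE : l = \sum_(n < D) component grL n l.
    have [N hN] := component_bound closedL sumL l.
    rewrite {1}(hN _ (leq_maxl N D)).
    rewrite (big_ord_widen _ (fun n => component grL n l) (leq_maxr N D)).
    rewrite [RHS]big_mkcond; apply: eq_bigr => i _; case: ltnP => // Di.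
    by rewrite (boundL Di (component_in closedL sumL i l)).
  rewrite {2}lE linear_sum; apply: eq_bigr => n _.
  rewrite -(component_morph n (phi0 _) closedX sumX closedY sumY (f := delta)) //; last first.
    by move=> x y; rewrite linearB.
  have -> : delta (phi0 (component grL n l)) = u (component grL n l) by exact: phi0E.
  rewrite (component_homogeneous closedY sumY n (u_gr (component_in closedL sumL n l))).
  by rewrite eqxx.
rewrite /phi rpred_sum // => i _; rewrite (component_homogeneous closedL sumL i hl).
case: eqP => [->|_]; first exact: component_in.
have -> : phi0 0 = 0 by exact: linear0.
by rewrite component0 // rpred0.
Qed.
End HomogeneousLift.

Section ConcentratedGrading.
Variables (V : zmodType) (k : nat).

Definition concentrated_gr (n : nat) : {pred V} :=
  fun v => (n == k) || (v == 0).

Lemma concentrated_gr_closed n : zmod_closed (concentrated_gr n).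
Proof.
split; first by rewrite unfold_in eqxx orbT.
move=> x y; rewrite !unfold_in; case: eqP => //= _ /eqP -> /eqP ->.
by rewrite subrr.
Qed.

Lemma concentrated_gr_sum : is_direct_sum concentrated_gr.
Proof.
split=> [v|n c hc sum0 i lt_in].
  exists k.+1, (fun i => if i == k then v else 0); split=> [i|].
    by rewrite unfold_in; case: eqP => //= _; rewrite eqxx.
  rewrite big_ord_recr /= eqxx big1 ?add0r // => i _.
  by rewrite ltn_eqF.
have [ik|/negPf ik] := eqVneq i k; last first.
  by have := hc i; rewrite unfold_in ik => /eqP.
move: sum0; rewrite (bigD1 (Ordinal lt_in)) //= big1 ?addr0 // => m mi.
have := hc m; rewrite unfold_in => /orP[/eqP mk|/eqP] //.
by case/eqP: mi; apply: val_inj; rewrite /= ik.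
Qed.
End ConcentratedGrading.

Lemma augmentation_linear (S : nzRingType) (A : lalgType S) (eps : {rmorphism A -> S}) :
  linear (eps : A^o -> aug_lmod eps).
Proof. by move=> a x y; rewrite rmorphD; congr (_ + _); exact: rmorphM. Qed.

Section Comparison.
Variables (S : nzRingType) (A : lalgType S) (gr : nat -> submodClosed A).
Variables (eps : {rmorphism A -> S}) (P : graded_projective_resolution gr eps).
Variables (Q1 Q2 : lmodType A) (d1 : {linear Q1 -> A^o}) (d2 : {linear Q2 -> Q1}).
Hypothesis eps_surj : forall s, exists a, eps a = s.
Hypothesis exactQ0 : forall a, eps a = 0 -> exists y, d1 y = a.
Hypothesis exactQ1 : forall y, d1 y = 0 -> exists z, d2 z = y.
Variables (g0 : {linear A^o -> P 0}) (g1 : {linear Q1 -> P 1}) (g2 : {linear Q2 -> P 2}).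
Hypothesis augg0 : forall a, res_aug P (g0 a) = eps a.
Hypothesis g1E : forall y, res_d P 0 (g1 y) = g0 (d1 y).
Hypothesis g2E : forall z, res_d P 1 (g2 z) = g1 (d2 z).

Lemma res_dd i q : res_d P i (res_d P i.+1 q) = 0.
Proof. by apply/res_exact; exists q. Qed.

Lemma res_aug_d q : res_aug P (res_d P 0 q) = 0.
Proof. by apply/res_exact0; exists q. Qed.

(** The usual comparison argument, cut off where Q stops. Only the modules of P are lifted along
    here: the maps f use exactness of Q up to Q1, and the homotopy uses exactness of P. *)
Lemma comparison_homotopy :
  exists (f2 : {linear P 2 -> Q2}) (h1 : {linear P 1 -> P 2}) (h2 : {linear P 2 -> P 3}),
  forall p, res_d P 2 (h2 p) = g2 (f2 p) - p - h1 (res_d P 1 p).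
Proof.
pose me := GRing.isLinear.Build _ _ _ _ (eps : A^o -> aug_lmod eps) (augmentation_linear eps).
pose epsL := HB.pack_for {linear A^o -> aug_lmod eps} (eps : A^o -> aug_lmod eps) me.
have [f0 f0E] := projective_lift (g := epsL) (@res_projective _ _ _ _ P 0)
  (fun p => eps_surj (res_aug P p)).
have [p|f1 f1E] := projective_lift (g := d1) (f := f0 \o res_d P 0) (@res_projective _ _ _ _ P 1).
  by apply: exactQ0; rewrite /= [LHS]f0E res_aug_d.
have [p|f2 f2E] := projective_lift (g := d2) (f := f1 \o res_d P 1) (@res_projective _ _ _ _ P 2).
  by apply: exactQ1; rewrite f1E /= res_dd linear0.
have [p|h0 h0E] := projective_lift (g := res_d P 0) (f := (g0 \o f0) \- idfun)
    (@res_projective _ _ _ _ P 0).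
  apply/res_exact0; rewrite linearB /= augg0 (f0E p : eps (f0 p) = res_aug P p); exact: subrr.
have [p|h1 h1E] := projective_lift (g := res_d P 1)
    (f := (g1 \o f1) \- idfun \- (h0 \o res_d P 0)) (@res_projective _ _ _ _ P 1).
  by apply/res_exact; rewrite !linearB /= g1E f1E h0E /= subrr.
have [p|h2 h2E] := projective_lift (g := res_d P 2)
    (f := (g2 \o f2) \- idfun \- (h1 \o res_d P 1)) (@res_projective _ _ _ _ P 2).
  apply/res_exact; rewrite !linearB /= g2E f2E h1E /= res_dd linear0 subr0.
  by rewrite subrr.
by exists f2, h1, h2 => p; rewrite h2E.
Qed.
End Comparison.

(** * Boundaries in P_2 of degree at least d + 3 *)

Section TorBound.
Variables (S : nzRingType) (A : lalgType S) (gr : nat -> submodClosed A).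
Hypotheses (grA : is_graded_ring gr) (connA : is_connected gr)
  (strA : is_strongly_graded gr).
Variables (T : lalgType S) (j : {linear submod (gr 1%N) -> T}).
Hypothesis tensT : is_tensor_ring j.
Variable pi : {lrmorphism T -> A}.
Hypothesis canpi : is_canonical_map j pi.
Variable R : submodClosed T.
Hypothesis relR : is_bimodule_of_relations j pi R.
Hypotheses (projA1 : projective (submod (gr 1%N))) (projR : projective (submod R)).
Variable eps : {rmorphism A -> S}.
Hypothesis epsA : is_augmentation gr eps.
Variable P : graded_projective_resolution gr eps.
Variable d : nat.
Hypothesis gr_top : forall n a, (d < n)%N -> a \in gr n -> a = 0.

Local Notation L1 := (submod (gr 1%N)).
Local Notation L2 := (submod R).
Local Notation tdeg := (tensor_ring_deg j).
Local Notation M1 := (induced A L1).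
Local Notation M2 := (induced A L2).
Local Notation cmp i n := (component (res_gr P i) n).

Let closedP i n : zmod_closed (res_gr P i n). Proof. exact: zmodClosedP. Qed.
Let sumP i : is_direct_sum (res_gr P i). Proof. exact: res_direct_sum. Qed.
Let actP i n m (a : A) (p : P i) : a \in gr n -> p \in res_gr P i m ->
  a *: p \in res_gr P i (n + m)%N.
Proof. exact: res_graded. Qed.

Lemma res_d_component i n (p : P i.+1) : cmp i n (res_d P i p) = res_d P i (cmp i.+1 n p).
Proof.
apply: (component_morph (f := res_d P i) _ _ (closedP i.+1) (sumP i.+1) (closedP i) (sumP i)).
  by move=> x y; exact: linearB.
by move=> m x; exact: res_d_homogeneous.
Qed.

Section Chain.
Variable del : {linear T -> restr M1}.
Hypothesis del1 : del 1 = 0.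
Hypothesis delj : forall v, del (j v) = ipure 1 v.
Hypothesis delM : forall t u, eps (pi u) = 0 -> del (t * u) = pi t *: (del u : M1).
Variable d1 : {linear M1 -> A^o}.
Hypothesis d1E : forall a v, d1 (ipure a v) = a * val v.
Variable d2 : {linear M2 -> M1}.
Hypothesis d2E : forall a r, d2 (ipure a r) = a *: (del (val r) : M1).

(** Each g_i is a homogeneous lift on the generators L_i, extended to A (x)_S L_i. Homogeneity of g2
    is stated on pure tensors, so that A (x)_S R needs no grading of its own. *)
Lemma graded_chain_map : exists (g0 : {linear A^o -> P 0}) (g1 : {linear M1 -> P 1})
    (g2 : {linear M2 -> P 2}),
  [/\ forall a, res_aug P (g0 a) = eps a,
      forall y, res_d P 0 (g1 y) = g0 (d1 y),
      forall z, res_d P 1 (g2 z) = g1 (d2 z) &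
      forall i k a (r : L2), a \in gr i -> tdeg k (val r) ->
        g2 (ipure a r) \in res_gr P 2 (i + k)%N].
Proof.
have [p hp] := res_aug_surjective P (1 : S).
pose p0 := cmp 0 0 p.
have p0gr : p0 \in res_gr P 0 0 by exact: component_in.
(* The augmentation of P kills positive degrees, so passing to the degree 0 component of p preserves
   its value 1. *)
have p0aug : res_aug P p0 = (1 : S).
  have [N hN] := component_bound (closedP 0) (sumP 0) p.
  rewrite -hp [in RHS](hN N.+1) // linear_sum big_ord_recl big1 ?addr0 // => i _.
  apply: (@res_aug_homogeneous _ _ _ _ P i.+1) => //.
  exact: (component_in (closedP 0) (sumP 0)).
pose g0f (a : A^o) : P 0 := (a : A) *: p0.
have lin_g0 : linear g0f by move=> a x y; rewrite /g0f scalerDl scalerA.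
pose m0 := GRing.isLinear.Build _ _ _ _ g0f lin_g0.
pose g0 := HB.pack_for {linear A^o -> P 0} g0f m0.
have aug0 a : res_aug P (g0 a) = eps a.
  rewrite [LHS]linearZ_LR p0aug; exact: mulr1.
have g0gr n (a : A) : a \in gr n -> g0 a \in res_gr P 0 n.
  by move=> ha; rewrite -[n]addn0; exact: actP.
have [u1 u1E] := restr_linear (g0 \o d1).
(* As an S-module of generators, A^1 is concentrated in degree 1, whence the bound 2. *)
have [||||phi1 [phi1E phi1gr]] := @homogeneous_lift _ _ _ grA _ _
    (@concentrated_gr_closed L1 1) (@concentrated_gr_sum L1 1) _ 2 _ projA1 _ _
    _ _ (sumP 1) (sumP 0) (@actP 1) (res_d P 0) (@res_d_homogeneous _ _ _ _ P 0) u1.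
- move=> n s l; rewrite !unfold_in => /orP[->//|/eqP ->].
  by rewrite scaler0 eqxx orbT.
- by move=> [|[|n]] l // _; rewrite unfold_in => /eqP.
- move=> n v; rewrite unfold_in u1E /= d1E mul1r => /orP[/eqP ->|/eqP ->].
    by apply: g0gr; exact: (valP v).
  by rewrite (_ : g0f _ = 0) ?rpred0 //; exact: scale0r.
- move=> v; apply/res_exact0; rewrite u1E /= aug0.
  exact: (eps_boundary1 epsA d1E).
have [g1 g1E] := induced_extension phi1.
have g1d y : res_d P 0 (g1 y) = g0 (d1 y).
  apply: (induced_ext (f := res_d P 0 \o g1) (g := g0 \o d1)) => v.
  by rewrite /= g1E scale1r phi1E u1E.
have g1gr n t : tdeg n t -> g1 (del t) \in res_gr P 1 n.
  case: n => [[s _ <-]|n ht].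
    by rewrite /= [del _]linearZ_LR del1 scaler0 linear0 rpred0.
  have [jr _ _] := tensT; have := tdegS_right jr (gr1_right grA) ht.
  apply: (mulspan_ind (Pr := fun t => g1 (del t) \in res_gr P 1 n.+1)).
  - by rewrite [del 0]linear0 linear0 rpred0.
  - by move=> x y hx hy; rewrite [del _]linearD linearD rpredD.
  move=> u _ hu [v _ <-]; rewrite delM; last first.
    by rewrite canpi; apply/(eps_gr1 epsA)/(valP v).
  rewrite linearZ_LR delj g1E scale1r -[n.+1]addn1; apply: actP.
    exact: (pi_deg grA canpi).
  by apply: phi1gr; rewrite unfold_in eqxx.
have [u2 u2E] := restr_linear (g1 \o d2).
(* The bound d + 2 on the degrees of R is [relation_degree_bound]. *)
have [||||phi2 [phi2E phi2gr]] := @homogeneous_lift _ _ _ grA _ _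
    (@relation_gr_closed _ _ _ _ j R) (relation_gr_sum tensT relR) _ d.+2 _ projR _ _
    _ _ (sumP 2) (sumP 1) (@actP 2) (res_d P 1) (@res_d_homogeneous _ _ _ _ P 1) u2.
- exact: relation_gr_scale.
- move=> n r dn /asboolP hr; apply: val_inj; rewrite raddf0.
  exact: (relation_degree_bound grA canpi relR gr_top (valP r) hr dn).
- move=> n r /asboolP hr; rewrite u2E /= d2E scale1r.
  exact: g1gr.
- move=> r; apply/res_exact; rewrite u2E /= g1d.
  by rewrite (boundary12 grA tensT canpi relR epsA del1 delj delM d1E d2E) linear0.
have [g2 g2E] := induced_extension phi2.
exists g0, g1, g2; split=> // [z|i k a r ha hr].
  apply: (induced_ext (f := res_d P 1 \o g2) (g := g1 \o d2)) => r.
  by rewrite /= g2E scale1r phi2E u2E.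
rewrite g2E; apply: actP => //; apply: phi2gr; exact/asboolP.
Qed.

Variables (g1 : {linear M1 -> P 1}) (g2 : {linear M2 -> P 2}).
Hypothesis g2d : forall z, res_d P 1 (g2 z) = g1 (d2 z).
Hypothesis g2gr : forall i k a (r : L2), a \in gr i -> tdeg k (val r) ->
  g2 (ipure a r) \in res_gr P 2 (i + k)%N.

Let aug_image (x : P 2) := exists2 q : P 3, aug_part eps q & res_d P 2 q = x.
Let aug_image0 : aug_image 0.
Proof. by exists 0; [exact: AugPart0|exact: linear0]. Qed.
Let aug_imageB x y : aug_image x -> aug_image y -> aug_image (x - y).
Proof.
by move=> [p hp <-] [q hq <-]; exists (p - q); [exact: AugPartB|exact: linearB].
Qed.
Let aug_imageD x y : aug_image x -> aug_image y -> aug_image (x + y).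
Proof.
by move=> [p hp <-] [q hq <-]; exists (p + q); [exact: aug_partD|exact: linearD].
Qed.

(** By additivity y is a (x) r with a and r homogeneous of degrees i and k, and only i + k = n
    contributes. The room between d + 2 and d + 3 lets one factor of A^1 be taken out of a. *)
Lemma component_comparison n y : (d.+3 <= n)%N -> aug_image (cmp 2 n (g2 y)).
Proof.
move=> dn; elim/induced_ind: y => [a r|y z IHy IHz]; last first.
  by rewrite linearB componentB //; exact: aug_imageB.
have [N1 h1] := component_bound (gr_ring_closed gr) (gr_ring_sum grA) a.
rewrite (h1 N1) //; elim/big_ind: _ => [|b c hb hc|i _].
- by rewrite ipure0l linear0 component0.
- by rewrite ipureDl linearD componentD //; exact: aug_imageD.
move: (component_in (gr_ring_closed gr) (gr_ring_sum grA) i a).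
move: (component gr i a) => {h1} {}a ha.
have [N2 h2] := component_bound (@relation_gr_closed _ _ _ _ j R) (relation_gr_sum tensT relR) r.
rewrite (h2 N2) //; elim/big_ind: _ => [|b c hb hc|k _].
- by rewrite ipure0r linear0 component0.
- by rewrite ipureDr linearD componentD //; exact: aug_imageD.
move: (component_in (@relation_gr_closed _ _ _ _ j R) (relation_gr_sum tensT relR) k r).
move: (component _ k r) => {h2} {}r /asboolP hr.
rewrite (component_homogeneous (closedP 2) (sumP 2) n (g2gr ha hr)).
case: eqP => [nE|_]; last exact: aug_image0.
(* Either r vanishes for degree reasons, or k < d + 2 forces i > 0. *)
have [dk|kd] := leqP d.+2 k.
  have -> : r = 0.
    apply: val_inj; rewrite raddf0.
    exact: (relation_degree_bound grA canpi relR gr_top (valP r) hr dk).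
  by rewrite ipure0r linear0.
case: (nat_of_ord i) ha nE => [_ nE|i' ha nE].
  by move: dn; rewrite nE add0n leqNgt ltnS (ltnW kd).
have := gr_mulspan strA (n := 1) (m := i') ha.
apply: (mulspan_ind (Pr := fun a => aug_image (g2 (ipure a r)))).
- by rewrite ipure0l linear0.
- by move=> b c hb hc; rewrite ipureDl linearD; exact: aug_imageD.
(* Here a = v b, and b (x) r has degree n - 1 >= d + 2, so d2 kills it. Its image under g2 is then a
   cycle, hence some d q, and v q lies in A_+ P_3. *)
move=> v b hv hb; rewrite -ipureZ linearZ_LR.
have [|q qE] := (res_exact (g2 (ipure b r))).1.
  rewrite g2d (boundary2_high grA connA strA tensT canpi relR epsA delM d2E
    gr_top hb hr) ?linear0 //.
  by move: dn; rewrite nE addSn ltnS.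
rewrite -qE; exists (v *: q); last exact: linearZ.
by apply: AugPartZ; exact: (eps_gr1 epsA).
Qed.
End Chain.

Lemma tor3_key n (p : P 3) : (d.+3 <= n)%N -> p \in res_gr P 3 n ->
  aug_part eps (res_d P 2 p) ->
  exists2 q : P 3, aug_part eps q & res_d P 2 q = res_d P 2 p.
Proof.
move=> dn hp augp.
have [del [del1 delj delM]] := fox_exists grA tensT canpi epsA.
have [d1 d1E] := boundary1_exists gr.
have [d2 d2E] := boundary2_exists R del.
have [theta [thetaE theta_sum]] := tensor_ring_grading tensT.
have [g0 [g1 [g2 [aug0 g1d g2d g2gr]]]] := graded_chain_map del1 delj delM d1E d2E.
have [f2 [h1 [h2 h2E]]] := comparison_homotopy
  (fun s => ex_intro _ s%:A (epsA.1 s))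
  (exact0 grA connA strA epsA d1E)
  (exact1 grA connA strA tensT canpi relR epsA delj delM d1E d2E thetaE theta_sum)
  aug0 g1d g2d.
pose x := res_d P 2 p.
(* The h1 term of the homotopy disappears since x is a boundary. *)
have xE : x = g2 (f2 x) - res_d P 2 (h2 x).
  by rewrite h2E /x res_dd linear0 subr0 opprB addrC subrK.
have xgr : x \in res_gr P 2 n by exact: res_d_homogeneous.
have [q1 hq1 q1E] := component_comparison delM d2E g2d g2gr (f2 x) dn.
(* Taking degree n components makes up for f2 and h2 not being homogeneous. *)
exists (q1 - cmp 3 n (h2 x)).
  apply: AugPartB => //; apply: (aug_part_component grA (sumP 3) (@actP 3) epsA).
  exact: aug_part_linear.
rewrite linearB q1E -res_d_component -componentB // -xE.
by rewrite (component_homogeneous (closedP 2) (sumP 2) n xgr) eqxx.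
Qed.
End TorBound.

(** * Tor in each degree, and the complexities *)

Section TorDegrees.
Variables (S : nzRingType) (A : lalgType S) (gr : nat -> submodClosed A).
Hypothesis grA : is_graded_ring gr.
Variable eps : {rmorphism A -> S}.
Hypothesis epsA : is_augmentation gr eps.
Variable P : graded_projective_resolution gr eps.
Local Notation cmp i n := (component (res_gr P i) n).
Local Notation pure1 p := (pure (1 : aug_rmod eps) p).

Let closedP i n : zmod_closed (res_gr P i n). Proof. exact: zmodClosedP. Qed.
Let sumP i : is_direct_sum (res_gr P i). Proof. exact: res_direct_sum. Qed.
Let actP i n m (a : A) (p : P i) : a \in gr n -> p \in res_gr P i m ->
  a *: p \in res_gr P i (n + m)%N.
Proof. exact: res_graded. Qed.

Lemma tor_d_pure1 i (p : P i.+1) :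
  tor_d (pure1 p : tor_complex P i.+1) = pure1 (res_d P i p) :> tor_complex P i.
Proof. exact: tensor_map_pure. Qed.

Lemma pure1D i (p q : P i) :
  pure1 (p + q) = (pure1 p : tor_complex P i) + (pure1 q : tor_complex P i).
Proof. exact: pureDr. Qed.

Lemma pure1_sum i (I : Type) (s : seq I) (F : I -> P i) :
  pure1 (\sum_(k <- s) F k) = \sum_(k <- s) (pure1 (F k) : tor_complex P i) :> tor_complex P i.
Proof. exact: (big_morph _ (@pure1D i) (pure0r _ _)). Qed.

Lemma tor_complex_deg_pure1 i n (z : tor_complex P i) :
  tor_complex_deg n z <-> exists2 p : P i, p \in res_gr P i n & z = pure1 p.
Proof.
split=> [[s [hs ->]]|[p hp ->]]; last first.
  exists [:: (1 : S, p)]; split; last by rewrite big_seq1.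
  by move=> u; rewrite inE => /eqP ->.
exists (\sum_(u <- s) u.1%:A *: u.2).
  rewrite big_seq rpred_sum // => u us; rewrite -[n]add0n; apply: actP; last exact: hs.
  by apply: rpredZ; case: grA.
rewrite pure1_sum; apply: eq_bigr => u _.
exact: (pureE_aug epsA).
Qed.

(** The cycle 1 (x) p means d p in A_+ P_i. If d q = d p with q in A_+ P_(i+1), then p - q is a
    cycle of P, hence a boundary d w, and 1 (x) p = 1 (x) d w; components put w in degree n. *)
Lemma tor_deg_eq0P i n :
  (forall p : P i.+1, p \in res_gr P i.+1 n -> aug_part eps (res_d P i p) ->
     exists2 q : P i.+1, aug_part eps q & res_d P i q = res_d P i p) ->
  tor_deg_eq0 P i.+1 n.
Proof.
move=> key z [cyc /tor_complex_deg_pure1[p hp zE]].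
have {cyc} : tor_d z = 0 by [].
rewrite zE tor_d_pure1 => /(pure1_aug_eq0 epsA) /(key p hp)[q hq dq].
have [|w wE] := (res_exact (p - q)).1; first by rewrite linearB dq subrr.
have pE : p = res_d P i.+1 (cmp i.+2 n w) + cmp i.+1 n q.
  have -> : res_d P i.+1 (cmp i.+2 n w) = cmp i.+1 n (res_d P i.+1 w).
    apply/esym/component_morph => //; first by move=> x y; rewrite linearB.
    by move=> m x; exact: res_d_homogeneous.
  by rewrite -componentD // wE subrK (component_homogeneous _ _ n hp) // eqxx.
exists (pure1 (cmp i.+2 n w)).
  by apply/tor_complex_deg_pure1; eexists; [exact: (component_in _ (sumP i.+2))|].
rewrite tor_d_pure1 [in RHS]pE pure1D.
have -> : (pure1 (cmp i.+1 n q) : tor_complex P i.+1) = 0.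
  by apply/(pure1_aug_eq0 epsA)/(aug_part_component grA (sumP i.+1) (@actP i.+1) epsA).
by rewrite addr0.
Qed.

(** As A_+ P_i is graded, the homogeneous components of a cycle are cycles. By contraposition, a
    nonzero Tor has some nonzero degree. *)
Lemma tor_eq0_degrees i : (forall n, tor_deg_eq0 P i.+1 n) -> tor_eq0 P i.+1.
Proof.
move=> deg0 z cyc; have [p zE] := tensor_aug_pure1 epsA z.
have {cyc} : tor_d z = 0 by [].
rewrite zE tor_d_pure1 => /(pure1_aug_eq0 epsA) augp.
have [N hN] := component_bound (closedP i.+1) (sumP i.+1) p.
rewrite (hN N) // pure1_sum.
apply: (big_ind (fun y : tor_complex P i.+1 =>
  exists2 w : tor_complex P i.+2, setT w & tor_d w = y)).
- by exists 0 => //; exact: raddf0.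
- by move=> _ _ [x _ <-] [y _ <-]; exists (x + y) => //; exact: raddfD.
move=> n _; have [|w _ wE] := deg0 n (pure1 (cmp i.+1 n p)); last by exists w.
split.
  suff: tor_d (pure1 (cmp i.+1 n p) : tor_complex P i.+1) = 0 by [].
  rewrite tor_d_pure1; apply/(pure1_aug_eq0 epsA).
  have -> : res_d P i (cmp i.+1 n p) = cmp i n (res_d P i p).
    apply/esym/component_morph => //; first by move=> x y; rewrite linearB.
    by move=> m x; exact: res_d_homogeneous.
  exact: (aug_part_component grA (sumP i) (@actP i) epsA).
by apply/tor_complex_deg_pure1; eexists; [exact: (component_in _ (sumP i.+1))|].
Qed.
End TorDegrees.

(** * Suprema of the values n - 1 over sets of naturals *)

Section Supremum.
Local Open Scope ereal_scope.
Local Open Scope classical_set_scope.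

Lemma supremum_max (X : set nat) d : X d -> (forall n, X n -> (n <= d)%N) ->
  supremum (-oo : \bar int) [set ((n%:Z - 1)%:E)%E | n in X] = (d%:Z - 1)%:E.
Proof.
move=> Xd Xmax; set Y := [set _ | n in X].
have Yd : Y (d%:Z - 1)%:E by exists d.
have ubY : ubound Y (d%:Z - 1)%:E.
  by move=> _ [n Xn <-]; rewrite lee_fin lerD2r lez_nat; exact: Xmax.
rewrite /supremum; case: ifPn => [/eqP Y0|_]; first by move: Yd; rewrite Y0.
case: xgetP => [y _ [uby lby]|/(_ (d%:Z - 1)%:E)]; last first.
  by case; split=> // y; exact.
by apply/eqP; rewrite eq_le (uby _ Yd) andbT; exact: lby.
Qed.

Lemma supremum_unbounded (X : set nat) : (forall d, exists2 n, X n & (d < n)%N) ->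
  supremum (-oo : \bar int) [set ((n%:Z - 1)%:E)%E | n in X] = +oo.
Proof.
move=> Xub; set Y := [set _ | n in X].
have ubY (y : \bar int) : ubound Y y -> y = +oo.
  move=> uby; have hn n : X n -> (n%:Z - 1)%:E <= y by move=> Xn; apply: uby; exists n.
  case: y {uby} hn => [m| |] // hn; last first.
    by have [n Xn _] := Xub 0%N; have := hn n Xn.
  have [n Xn nm] := Xub `|m|.+1%N.
  by have := hn n Xn; rewrite lee_fin; lia.
have [n Xn _] := Xub 0%N.
have Yn : Y (n%:Z - 1)%:E by exists n.
rewrite /supremum; case: ifPn => [/eqP Y0|_]; first by move: Yn; rewrite Y0.
case: xgetP => [y _ [uby _]|/(_ +oo)]; first exact: ubY.
case; split=> [y _|y /ubY ->]; first exact: leey.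
exact: lexx.
Qed.

Lemma nat_set_bounded_or (X : set nat) n0 : X n0 ->
  (exists2 d, X d & forall n, X n -> (n <= d)%N) \/
  (forall d, exists2 n, X n & (d < n)%N).
Proof.
move=> X0; have [[b hb]|nb] := pselect (exists b, forall n, X n -> (n <= b)%N); [left|right].
  have ex : exists n, `[< X n >] by exists n0; exact/asboolP.
  have ub n : `[< X n >] -> (n <= b)%N by move/asboolP/hb.
  case: (ex_maxnP ex ub) => d /asboolP Xd dmax; exists d => // n Xn.
  by apply: dmax; exact/asboolP.
move=> d; apply: contrapT => h; apply: nb; exists d => n Xn.
by rewrite leqNgt; apply/negP => dn; apply: h; exists n.
Qed.
End Supremum.

Local Open Scope ereal_scope.

Theorem mainTheorem20
  (* a strongly graded connected S-ring A *)
  (S : nzRingType) (A : lalgType S) (gr : nat -> submodClosed A)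
  (grA : is_graded_ring gr) (connA : is_connected gr)
  (strA : is_strongly_graded gr)
  (* the tensor S-ring T = T_S(A^1) and its canonical map onto A *)
  (T : lalgType S) (j : {linear submod (gr 1%N) -> T})
  (tensT : is_tensor_ring j)
  (pi : {lrmorphism T -> A}) (canpi : is_canonical_map j pi)
  (* a bimodule of relations *)
  (R : submodClosed T) (relR : is_bimodule_of_relations j pi R)
  (* A^1 and R are projective as left S-modules *)
  (projA1 : projective (submod (gr 1%N))) (projR : projective (submod R))
  (* S as an A-module, and a graded projective resolution of it, from which
     Tor^A(S,S) is computed *)
  (eps : {rmorphism A -> S}) (augeps : is_augmentation gr eps)
  (P : graded_projective_resolution gr eps) :
  homological_complexity P <= complexity gr + 2%:E /\
  (complexity gr \is a fin_num -> homological_complexity P \is a fin_num).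
Proof.
pose X := [set n | exists2 a, a \in gr n & a != 0%R]%classic.
have X0 : X 0%N by exists 1%R; [case: grA|exact: oner_neq0].
(* Without a top degree the complexity of A is +oo, and both claims are immediate. *)
have [[d Xd dmax]|Xub] := nat_set_bounded_or X0; last first.
  have -> : complexity gr = +oo := supremum_unbounded Xub.
  by split=> //; exact: leey.
have gr_top n a : (d < n)%N -> a \in gr n -> a = 0%R.
  move=> dn ha; apply/eqP; apply: contraTT dn => a0; rewrite -leqNgt.
  by apply: dmax; exists a.
have -> : complexity gr = (d%:Z - 1)%:E := supremum_max Xd dmax.
have tor0 n : (d.+3 <= n)%N -> tor_deg_eq0 P 3 n.
  move=> dn; apply: (tor_deg_eq0P grA augeps) => p.
  exact: (tor3_key grA connA strA tensT canpi relR projA1 projR augeps gr_top dn).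
rewrite /homological_complexity; case: ifPn => [_|/asboolP tor3].
  split=> //; rewrite -EFinD lee_fin; lia.
(* A degree with nonzero Tor_3 keeps the supremum from being -oo; with the bound d + 2 below, it is
   attained, hence finite. *)
have [n0 hn0] : exists n, ~ tor_deg_eq0 P 3 n.
  apply: contrapT => h; apply/tor3/(tor_eq0_degrees grA augeps) => n.
  by apply: contrapT => hn; apply: h; exists n.
have bound n : ~ tor_deg_eq0 P 3 n -> (n <= d.+2)%N.
  by rewrite leqNgt => h; apply/negP => /tor0.
have [[m hm mmax]|ub] :=
  @nat_set_bounded_or [set n | ~ tor_deg_eq0 P 3 n]%classic _ hn0; last first.
  by have [n /bound hn dn] := ub d.+2; move: dn; rewrite ltnNge hn.
rewrite (supremum_max hm mmax); split=> //.
(* The largest such degree m satisfies m - 1 <= d + 1 = (d - 1) + 2. *)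
rewrite -EFinD lee_fin; have := bound m hm; lia.
Qed.
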